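(* Let $(M,g)$ be a connected smooth Riemannian manifold, let $X$ be a complete smooth vector field on $M$, and let $p_0,q_0\in M$. Let $p(t)=\mathrm{Fl}^X_t(p_0)$ and $q(t)=\mathrm{Fl}^X_t(q_0)$, and suppose that $C:=\sup_{p\in M}\|\nabla X(p)\|_g<\infty$. Then $$d(p(t),q(t))\le d(p_0,q_0)\,e^{Ct}\qquad (t\in[0,\infty)),$$ where $d$ denotes the Riemannian distance on $(M,g)$.
   Context: $\nabla$ denotes the Levi-Civita connection of $(M,g)$, and $\nabla X$ is the covariant differential of $X$. $\|\nabla X(p)\|_g$ is the operator norm of the linear map $\nabla X(p):(T_pM,\|\cdot\|_g)\to(T_pM,\|\cdot\|_g)$, $Y_p\mapsto\nabla_{Y_p}X$. $\mathrm{Fl}^X$ denotes the flow of $X$, i.e. $t\mapsto\mathrm{Fl}^X_t(p)$ is the maximal integral curve of $X$ with value $p$ at $t=0$; $X$ is complete if all its integral curves are defined for all $t\in\mathbb{R}$. The Riemannian metric $g$ is not assumed to be complete. *)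

(* Defs.v *)
From HB Require Import structures.
From mathcomp Require Import all_boot all_order all_algebra.
From mathcomp Require Import all_classical all_reals all_analysis.
Import Order.TTheory GRing.Theory Num.Theory.
Import numFieldNormedType.Exports.

Set Implicit Arguments.
Unset Strict Implicit.
Unset Printing Implicit Defensive.

Local Open Scope classical_set_scope.
Local Open Scope ring_scope.

(* [U] is meant to be open. In finite dimension this is the usual C^k: f is
   C^(k+1) iff it is differentiable with all directional derivatives C^k. *)
Fixpoint Ck_on (R : realType) (V W : normedModType R) (k : nat) (U : set V)
    (f : V -> W) : Prop :=
  match k with
  | 0%N => forall x, U x -> {for x, continuous f}
  | k'.+1 => (forall x, U x -> differentiable f x) /\
             (forall v, Ck_on k' U (fun x => 'D_v f x))
  end.

Definition Cinf_on (R : realType) (V W : normedModType R) (U : set V)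
    (f : V -> W) : Prop := forall k, Ck_on k U f.

(* [chart_map] is total, but only its restriction to [chart_dom] matters; it is
   a homeomorphism from [chart_dom] onto an open set, with inverse
   [chart_inv]. *)
Record chart (R : realType) (n : nat) (M : topologicalType) := Chart {
  chart_dom : set M;
  chart_map :> M -> 'rV[R]_n;
  chart_inv : 'rV[R]_n -> M;
  chart_dom_open : open chart_dom;
  chart_img_open : open (chart_map @` chart_dom);
  chart_mapK : forall p, chart_dom p -> chart_inv (chart_map p) = p;
  chart_map_continuous :
    forall p, chart_dom p -> {for p, continuous chart_map};
  chart_inv_continuous :
    forall x, (chart_map @` chart_dom) x -> {for x, continuous chart_inv} }.

(* The atlas need not be maximal. [chart_at] picks a chart around each point;
   it serves only to represent tangent vectors (see [tangent]). *)
Record smoothManifold (R : realType) (n : nat) := SmoothManifold {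
  carrier :> topologicalType;
  manifold_hausdorff : hausdorff_space carrier;
  manifold_second_countable : @second_countable carrier;
  atlas : set (chart R n carrier);
  chart_at : carrier -> chart R n carrier;
  chart_at_atlas : forall p, atlas (chart_at p);
  chart_at_dom : forall p, chart_dom (chart_at p) p;
  atlas_smooth : forall c c', atlas c -> atlas c' ->
    Cinf_on (c @` (chart_dom c `&` chart_dom c')) (c' \o chart_inv c) }.

(* T_p M: a tangent vector at p is given by its components in the chart
   [chart_at p]; [tangent_coord] yields its components in any other chart. *)
Definition tangent (R : realType) (n : nat) (M : smoothManifold R n) (p : M) :
  lmodType R := 'rV[R]_n.

Definition tangent_coord (R : realType) (n : nat) (M : smoothManifold R n)
    (c : chart R n M) (p : M) (v : tangent p) : 'rV[R]_n :=
  'D_v (c \o chart_inv (chart_at p)) (chart_at p p).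

(* v(f), the derivative of the function f along v in T_p M. *)
Definition tangent_der (R : realType) (n : nat) (M : smoothManifold R n)
    (p : M) (v : tangent p) (f : M -> R) : R :=
  'D_v (f \o chart_inv (chart_at p) : 'rV[R]_n -> R^o) (chart_at p p).

Definition smooth_fun (R : realType) (n : nat) (M : smoothManifold R n)
    (U : set M) (f : M -> R) : Prop :=
  forall c, atlas c ->
    Cinf_on (c @` (U `&` chart_dom c))
      (f \o chart_inv c : 'rV[R]_n -> R^o).

Definition vfield (R : realType) (n : nat) (M : smoothManifold R n) :=
  forall p : M, tangent p.

Definition smooth_vfield (R : realType) (n : nat) (M : smoothManifold R n)
    (U : set M) (X : vfield M) : Prop :=
  forall c, atlas c ->
    Cinf_on (c @` (U `&` chart_dom c))
      (fun x => tangent_coord c (X (chart_inv c x))).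

Record riemannian_metric (R : realType) (n : nat) (M : smoothManifold R n) :=
  RiemannianMetric {
  inner :> forall p : M, tangent p -> tangent p -> R;
  inner_sym : forall p (v w : tangent p), inner v w = inner w v;
  inner_linear : forall p (a : R) (u v w : tangent p),
    inner (a *: u + v) w = a * inner u w + inner v w;
  inner_gt0 : forall p (v : tangent p), v != 0 -> 0 < inner v v;
  inner_smooth : forall (U : set M) (X Y : vfield M), open U ->
    smooth_vfield U X -> smooth_vfield U Y ->
    smooth_fun U (fun p => inner (X p) (Y p)) }.

Definition tangent_norm (R : realType) (n : nat) (M : smoothManifold R n)
    (g : riemannian_metric M) (p : M) (v : tangent p) : R :=
  Num.sqrt (g p v v).

(* [cov v X] is the covariant derivative of X along v in T_p M. Connections are
   local operators, so X is only asked to be smooth near p; on other X the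
   value is unconstrained. Since f and X below range over functions and fields
   smooth near p only, the axioms make [cov v X] depend only on the germ of X
   at p, and such an operator is the same as a connection on TM. *)
Record affine_connection (R : realType) (n : nat) (M : smoothManifold R n) :=
  AffineConnection {
  cov :> forall p : M, tangent p -> vfield M -> tangent p;
  cov_linear : forall (U : set M) (X : vfield M) p (a : R) (u v : tangent p),
    open U -> U p -> smooth_vfield U X ->
    cov (a *: u + v) X = a *: cov u X + cov v X;
  cov_add : forall (U : set M) (X Y : vfield M) p (v : tangent p),
    open U -> U p -> smooth_vfield U X -> smooth_vfield U Y ->
    cov v (fun q => X q + Y q) = cov v X + cov v Y;
  cov_leibniz : forall (U : set M) (f : M -> R) (X : vfield M) p
      (v : tangent p),
    open U -> U p -> smooth_fun U f -> smooth_vfield U X ->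
    cov v (fun q => f q *: X q) = tangent_der v f *: X p + f p *: cov v X;
  cov_smooth : forall (U : set M) (X Y : vfield M), open U ->
    smooth_vfield U X -> smooth_vfield U Y ->
    smooth_vfield U (fun p => cov (Y p) X) }.

(* cov_X Y - cov_Y X = [X, Y], where [X, Y] f = X (Y f) - Y (X f). *)
Definition torsion_free (R : realType) (n : nat) (M : smoothManifold R n)
    (nabla : affine_connection M) : Prop :=
  forall (U : set M) (X Y : vfield M) (f : M -> R) (p : M),
    open U -> U p ->
    smooth_vfield U X -> smooth_vfield U Y -> smooth_fun U f ->
    tangent_der (nabla p (X p) Y - nabla p (Y p) X) f =
    tangent_der (X p) (fun q => tangent_der (Y q) f) -
    tangent_der (Y p) (fun q => tangent_der (X q) f).

Definition metric_compatible (R : realType) (n : nat) (M : smoothManifold R n)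
    (g : riemannian_metric M) (nabla : affine_connection M) : Prop :=
  forall (U : set M) (X Y : vfield M) (p : M) (v : tangent p),
    open U -> U p -> smooth_vfield U X -> smooth_vfield U Y ->
    tangent_der v (fun q => g q (X q) (Y q)) =
    g p (nabla p v X) (Y p) + g p (X p) (nabla p v Y).

Definition levi_civita (R : realType) (n : nat) (M : smoothManifold R n)
    (g : riemannian_metric M) (nabla : affine_connection M) : Prop :=
  torsion_free nabla /\ metric_compatible g nabla.

Definition operator_norm (R : realType) (n : nat) (M : smoothManifold R n)
    (g : riemannian_metric M) (p : M) (A : tangent p -> tangent p) : \bar R :=
  ereal_sup [set (tangent_norm g (A v))%:E |
             v in [set v : tangent p | tangent_norm g v <= 1]].

(* Meaningful where [gamma] is differentiable. *)
Definition velocity (R : realType) (n : nat) (M : smoothManifold R n)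
    (gamma : R -> M) (t : R) : tangent (gamma t) :=
  derive1 (fun s : R => chart_at (gamma t) (gamma s)) t.

(* Continuity at t keeps [gamma] inside the domain of [chart_at (gamma t)]
   near t, off which the chart map is arbitrary. *)
Definition integral_curve (R : realType) (n : nat) (M : smoothManifold R n)
    (X : vfield M) (J : set R) (gamma : R -> M) : Prop :=
  forall t, J t ->
    [/\ {for t, continuous gamma},
        derivable (fun s : R^o => chart_at (gamma t) (gamma s)) t 1 &
        velocity gamma t = X (gamma t)].

Definition integral_curve_from (R : realType) (n : nat)
    (M : smoothManifold R n) (X : vfield M) (p : M)
    (J : set R) (gamma : R -> M) : Prop :=
  [/\ open J, is_interval J, J 0, gamma 0 = p & integral_curve X J gamma].

Definition maximal_integral_curve (R : realType) (n : nat)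
    (M : smoothManifold R n) (X : vfield M) (p : M)
    (J : set R) (gamma : R -> M) : Prop :=
  integral_curve_from X p J gamma /\
  forall J' gamma', integral_curve_from X p J' gamma' ->
    J `<=` J' -> (forall t, J t -> gamma' t = gamma t) -> J' `<=` J.

(* The interval of definition and the values of the maximal integral curve of X
   starting at p (unique on that interval when X is smooth). *)
Definition flow_line (R : realType) (n : nat) (M : smoothManifold R n)
    (X : vfield M) (p : M) : set R * (R -> M) :=
  xget (set0, fun=> p) [set c | maximal_integral_curve X p c.1 c.2].

Definition flow (R : realType) (n : nat) (M : smoothManifold R n)
    (X : vfield M) (t : R) (p : M) : M := (flow_line X p).2 t.

Definition complete_vfield (R : realType) (n : nat) (M : smoothManifold R n)
    (X : vfield M) : Prop :=
  forall p, (flow_line X p).1 = setT.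

Definition C1_curve (R : realType) (n : nat) (M : smoothManifold R n)
    (J : set R) (gamma : R -> M) : Prop :=
  (forall t, J t -> {for t, continuous gamma}) /\
  (forall c, atlas c ->
     Ck_on 1 (J `&` gamma @^-1` chart_dom c : set R^o) (c \o gamma)).

(* C^1 on a compact subinterval [tau i, tau (i+1)] means being the restriction
   of a C^1 curve defined on an open neighbourhood of it. *)
Definition piecewise_C1 (R : realType) (n : nat) (M : smoothManifold R n)
    (a b : R) (gamma : R -> M) : Prop :=
  {within `[a, b], continuous gamma} /\
  exists (N : nat) (tau : nat -> R),
    [/\ tau 0%N = a, tau N = b &
        forall i, (i < N)%N -> tau i < tau i.+1 /\
          exists (J : set R) (sigma : R -> M),
            [/\ open J, `[tau i, tau i.+1] `<=` J, C1_curve J sigma &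
                forall t, tau i <= t <= tau i.+1 -> sigma t = gamma t]].

(* The integrand is the speed off the finitely many break points, which are
   negligible. *)
Definition curve_length (R : realType) (n : nat) (M : smoothManifold R n)
    (g : riemannian_metric M) (a b : R) (gamma : R -> M) : \bar R :=
  (\int[lebesgue_measure]_(t in `[a, b])
     (tangent_norm g (velocity gamma t))%:E)%E.

(* Extended-real valued: +oo when no curve joins p and q, which does not happen
   on a connected manifold. *)
Definition riemannian_dist (R : realType) (n : nat) (M : smoothManifold R n)
    (g : riemannian_metric M) (p q : M) : \bar R :=
  ereal_inf [set L | exists a b gamma,
    [/\ a < b, gamma a = p, gamma b = q, piecewise_C1 a b gamma &
        L = curve_length g a b gamma]].

(* Main.v *)
(* If gamma is piecewise C^1 from p0 to q0, then Fl_t o gamma is piecewise C^1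
   from p(t) to q(t), and its speed is at most e^(Ct) times that of gamma: along
   the flow the derivative V of s |-> Fl_t(gamma s) satisfies
   d/dt g(V, V) = (L_X g)(V, V) = 2 g(nabla_V X, V) <= 2 C g(V, V).
   Integrating and taking the infimum over gamma gives the estimate.

   Completeness provides all the integral curves, so neither the existence
   theorem for ODEs, nor uniqueness, nor the group property of the flow is needed.
   Differentiability of s |-> Fl_t(gamma s) is propagated in t through small
   time steps inside a chart: the divided differences of two trajectories solve
   the linearized equation up to a small error, hence form a Cauchy family. The
   bound on g(V, V) is likewise proved for divided differences and passes to the
   limit, so the variational equation itself never has to be solved. *)
Require Import Defs.
From HB Require Import structures.
From mathcomp Require Import all_boot all_order all_algebra.
From mathcomp Require Import all_classical all_reals all_analysis.
From mathcomp Require Import measurable_realfun ring lra.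
Import Order.TTheory GRing.Theory Num.Theory.
Import numFieldNormedType.Exports.
Local Open Scope classical_set_scope.
Local Open Scope ring_scope.
Set Implicit Arguments.
Unset Strict Implicit.
Unset Printing Implicit Defensive.

(** * Curves in row vectors and induction along the real line *)

Lemma rv_norm_le (R : realType) n (v : 'rV[R]_n) (K : R) :
  0 <= K -> (forall i, `|v 0 i| <= K) -> `|v| <= K.
Proof.
move=> K0 H; rewrite [leLHS]mx_normrE.
elim/big_ind: _ => // [x y hx hy|[i j] _]; first by rewrite ge_max hx.
by rewrite (ord1 i); exact: H.
Qed.

Lemma rv_norm_coord (R : realType) n (v : 'rV[R]_n) i : `|v 0 i| <= `|v|.
Proof.
rewrite [leRHS]mx_normrE.
exact: (@le_bigmax _ _ _ 0 (fun ij : 'I_1 * 'I_n => `|v ij.1 ij.2|) (0, i)).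
Qed.

Lemma is_derive_rvP (R : realType) (V : normedModType R) n (f : V -> 'rV[R]_n)
   (t v : V) (df : 'rV[R]_n) :
  is_derive t v f df <-> (forall i, is_derive t v (fun s => f s 0 i : R) (df 0 i)).
Proof.
split.
  move=> [d <-] i; split; first by move/derivable_mxP: d.
  by rewrite derive_mx // mxE.
move=> H; have d : derivable f t v.
  by apply/derivable_mxP => i j; rewrite (ord1 i); case: (H j).
split => //; rewrite derive_mx //; apply/rowP => j; rewrite mxE.
by case: (H j).
Qed.

Lemma is_derive_continuous (R : realType) n (f : R -> 'rV[R]_n) t df :
  is_derive t (1 : R) f df -> {for t, continuous f}.
Proof.
by move=> [/derivable1_diffP/differentiable_continuous].
Qed.

Lemma mvt_norm (R : realType) n (f df : R -> 'rV[R]_n) (a b K : R) :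
  a <= b -> (forall t, a <= t <= b -> is_derive t (1 : R) f (df t)) ->
  (forall t, a <= t <= b -> `|df t| <= K) -> `|f b - f a| <= K * (b - a).
Proof.
move=> ab fd dK.
have K0 : 0 <= K by apply: le_trans (dK a _); rewrite // lexx.
apply: rv_norm_le => [|i]; first by rewrite mulr_ge0// subr_ge0.
rewrite !mxE.
have fdi t : t \in `[a, b] -> is_derive t (1 : R) (fun s => f s 0 i : R) (df t 0 i).
  by rewrite in_itv/= => /fd/is_derive_rvP.
have cf : {within `[a, b], continuous (fun s => f s 0 i : R)}.
  by apply: derivable_within_continuous => x /fdi[].
have fd' x : x \in `]a, b[ -> is_derive x (1 : R) (fun s => f s 0 i : R) (df x 0 i).
  by move=> xab; apply: fdi; apply: subset_itv xab; rewrite bnd_simp.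
have [c cab ->] := MVT_segment ab fd' cf.
rewrite in_itv/= in cab.
rewrite normrM (@ger0_norm _ (b - a)) ?subr_ge0// ler_wpM2r ?subr_ge0//.
by apply: le_trans (dK _ cab); exact: rv_norm_coord.
Qed.

Lemma real_induction (R : realType) (P : R -> Prop) (a b : R) :
  P a ->
  (forall t, a <= t < b -> (forall u, a <= u <= t -> P u) ->
     exists2 d, 0 < d & forall u, t < u < t + d -> P u) ->
  (forall t, a < t <= b -> (forall u, a <= u < t -> P u) -> P t) ->
  forall t, a <= t <= b -> P t.
Proof.
move=> Pa Pright Pleft.
have [ba|ab] := ltP b a; first by move=> t /andP[] /le_trans/[apply]; rewrite leNgt ba.
pose A := [set t | a <= t <= b /\ forall u, a <= u <= t -> P u].
have Aa : A a by split; [rewrite lexx|move=> u; rewrite -eq_le => /eqP <-].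
have supA : has_sup A.
  by split; [exists a|exists b => t [/andP[]]].
have ubA := sup_upper_bound supA.
pose s := sup A.
have as_ : a <= s by exact: ubA.
have sb : s <= b by apply: sup_le_ub; [exists a|move=> t [/andP[]]].
have Ps' u : a <= u < s -> P u.
  move=> /andP[au us]; have [|t At ut] := @sup_adherent _ A (s - u) _ supA.
    by rewrite subr_gt0.
  case: At => _; apply; rewrite au/= ltW//.
  by move: ut; rewrite opprB addrC subrK.
have Ps : forall u, a <= u <= s -> P u.
  move=> u /andP[au]; rewrite le_eqVlt => /predU1P[->|us]; last by apply: Ps'; rewrite au.
  move: as_; rewrite le_eqVlt => /predU1P[<-//|as_].
  by apply: Pleft => //; rewrite as_.
suff sbE : s = b by rewrite -sbE.
apply/eqP; rewrite eq_le sb leNgt; apply/negP => sb'.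
have [|d d0 Hd] := Pright s _ Ps; first by rewrite as_ sb'.
pose m := Num.min b (s + d / 2).
have sm : s < m by rewrite lt_min sb' ltrDl divr_gt0.
have : m <= s.
  apply: ubA; split.
    by rewrite (le_trans as_ (ltW sm))/= ge_min lexx.
  move=> u /andP[au um]; have [us|us] := leP u s; first by apply: Ps; rewrite au.
  apply: Hd; rewrite us (le_lt_trans um)// gt_min; apply/orP; right.
  by rewrite ltrD2l ltr_pdivrMr// mulrC ltr_pMl// ltr1n.
by rewrite leNgt sm.
Qed.

(* The windows around t let P be propagated to t from slightly earlier times and
   from t to slightly later ones, which is what makes {t | P t} all of [0, +oo[. *)
Lemma forward_induction (R : realType) (P : R -> Prop) : P 0 ->
  (forall t, 0 <= t -> exists2 d, 0 < d & forall u v, 0 <= u -> u <= v ->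
     `|u - t| < d -> `|v - t| < d -> P u -> P v) ->
  forall t, 0 <= t -> P t.
Proof.
move=> P0 H t t0; apply: (@real_induction R P 0 t) => //; last by rewrite t0 lexx.
- move=> s /andP[s0 _] /(_ s); rewrite s0 lexx => /(_ isT) Ps.
  have [d d0 {}H] := H s s0; exists d => // u /andP[su ud].
  apply: (H s u) => //; rewrite ?ltW// ?subrr ?normr0// ltr_norml; lra.
- move=> s /andP[s0 _] Ps; have [d d0 {}H] := H s (ltW s0).
  pose m := Num.max 0 (s - d / 2).
  have ms : m < s by rewrite gt_max s0/=; lra.
  have m0 : 0 <= m by rewrite le_max lexx.
  have md : s - d / 2 <= m by rewrite le_max lexx orbT.
  apply: (H m s) => //; rewrite ?ltW// ?subrr ?normr0//.
    rewrite ltr_norml; lra.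
  by apply: Ps; rewrite m0.
Qed.

(* Replaces Gronwall's inequality, since the sup norm is not differentiable. *)
Lemma short_time_bound (R : realType) n (f df : R -> 'rV[R]_n) (a b K eta : R) :
  a <= b -> 0 <= K -> K * (b - a) <= 2^-1 -> 0 <= eta ->
  (forall t, a <= t <= b -> is_derive t (1 : R) f (df t)) ->
  (forall t, a <= t <= b -> `|df t| <= K * `|f t| + eta) ->
  forall t, a <= t <= b -> `|f t| <= 2 * (`|f a| + eta * (b - a)).
Proof.
move=> ab K0 Kab eta0 fd dK.
have [|c cab cmax] := @EVT_max R (fun t => `|f t|) a b ab.
  apply: continuous_in_subspaceT => x; rewrite inE/= in_itv/= => xab.
  by apply: cvg_norm; apply: is_derive_continuous; exact: fd.
rewrite in_itv/= in cab.
suff fc : `|f c| <= 2 * (`|f a| + eta * (b - a)).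
  by move=> t tab; apply: le_trans fc; apply: cmax; rewrite in_itv.
have : `|f c - f a| <= (K * `|f c| + eta) * (c - a).
  apply: (@mvt_norm _ _ f df) => [|t tac|t tac]; [by case/andP: cab|apply: fd; lra|].
  apply: le_trans (dK t _) _; first lra.
  by rewrite lerD2r ler_wpM2l// cmax// in_itv/=; lra.
have := ler_normD (f c - f a) (f a); rewrite subrK.
have : `|f c| * (K * (c - a)) <= `|f c| * 2^-1.
  by rewrite ler_wpM2l//; apply: le_trans Kab; rewrite ler_wpM2l//; lra.
have : eta * (c - a) <= eta * (b - a) by rewrite ler_wpM2l//; lra.
lra.
Qed.

(** * Calculus of C^k maps *)

Lemma diff_epsP (R : realType) (V W : normedModType R) (f : V -> W) x
    (L : {linear V -> W}) : continuous L ->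
  (forall e, 0 < e -> \forall y \near x, `|f y - f x - L (y - x)| <= e * `|y - x|) ->
  differentiable f x /\ 'd f x = L :> (V -> W).
Proof.
move=> cL H.
have E : f \o shift x = cst (f x) + L +o_ 0 id.
  apply/(eqaddoP (nbhs_filter_on (0 : V))) => e e0.
  suff : \forall y \near (0 : V),
      `|(f \o shift x - (cst (f x) + L)) y| <= e * `|y| by [].
  rewrite (near_shift x) sub0r; apply: filterS (H e e0) => y.
  by rewrite /= !fctE /= subrK opprD addrA.
have dE : 'd f x = L :> (V -> W) by exact: diff_unique.
split => //; apply/diff_locallyP; rewrite dE; split => //.
Qed.

Lemma diff_eps (R : realType) (V W : normedModType R) (f : V -> W) x :
  differentiable f x ->
  forall e, 0 < e -> \forall y \near x, `|f y - f x - 'd f x (y - x)| <= e * `|y - x|.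
Proof.
move=> df e e0; have := diff_locally df.
move/(eqaddoP (nbhs_filter_on (0 : V))) => /(_ e e0) h.
have {h} : \forall y \near (0 : V),
      `|(f \o shift x - (cst (f x) + 'd f x)) y| <= e * `|y| by [].
rewrite (near_shift x) sub0r; apply: filterS => y.
by rewrite /= !fctE /= subrK opprD addrA.
Qed.

Lemma near_eq_differentiable (R : realType) (V W : normedModType R) (f g : V -> W) x :
  (\near x, f x = g x) -> differentiable f x -> differentiable g x.
Proof.
move=> fg df; have fgx := nbhs_singleton fg.
apply: (proj1 (@diff_epsP R V W g x ('d f x) (diff_continuous df) _)) => e e0.
near=> y; rewrite -fgx -(near fg y) //; near: y; exact: diff_eps.
Unshelve. all: by end_near. Qed.

Lemma cvg_sumv (R : realType) (V : normedModType R) (I T : Type) (r : seq I)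
    (F : set_system T) {FF : Filter F} (f : I -> T -> V) (a : I -> V) :
  (forall i, f i x @[x --> F] --> a i) ->
  (\sum_(i <- r) f i x) @[x --> F] --> \sum_(i <- r) a i.
Proof.
by move=> H; apply: cvg_big => //; exact: add_continuous.
Qed.

Lemma cvg_rvP (R : realType) (T : Type) n (F : set_system T) {FF : Filter F}
    (f : T -> 'rV[R]_n) (a : 'rV[R]_n) :
  f x @[x --> F] --> a <-> (forall i, f x 0 i @[x --> F] --> a 0 i).
Proof.
split=> H.
  move=> i; apply: (@cvg_comp _ _ _ f (fun M : 'rV[R]_n => M 0 i) F (nbhs a) _ H).
  exact: coord_continuous.
rewrite (row_sum_delta a); under eq_cvg => x do rewrite (row_sum_delta (f x)).
by apply: cvg_sumv => i; apply: cvgZr_tmp; exact: H.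
Qed.

Section Ck.
Context {R : realType}.

Lemma Ck_cont (V W : normedModType R) k U (f : V -> W) :
  Ck_on k U f -> forall x, U x -> {for x, continuous f}.
Proof.
by case: k => [//|k] [df _] x /df/differentiable_continuous.
Qed.

Lemma Ck_S (V W : normedModType R) k U (f : V -> W) : Ck_on k.+1 U f -> Ck_on k U f.
Proof.
elim: k U f => [|k IH] U f; first exact: Ck_cont.
by move=> [df Df]; split => // v; apply: IH.
Qed.

Lemma Ck_sub (V W : normedModType R) k (U U' : set V) (f : V -> W) : U' `<=` U ->
  Ck_on k U f -> Ck_on k U' f.
Proof.
elim: k U f => [|k IH] U f UU' /=; first by move=> H x /UU'/H.
by move=> [df Df]; split => [x /UU'/df|v] //; apply: IH UU' _.
Qed.

Lemma Ck_ext (V W : normedModType R) k (U : set V) (f g : V -> W) : open U ->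
  (forall x, U x -> f x = g x) -> Ck_on k U f -> Ck_on k U g.
Proof.
move=> oU; have nU x : U x -> \forall y \near x, U y by move=> Ux; exact: open_nbhs_nbhs.
elim: k f g => [|k IH] f g fg /=.
  move=> H x Ux; rewrite /prop_for /continuous_at -(fg _ Ux).
  apply: cvg_trans (H x Ux); apply: near_eq_cvg.
  by near=> y; apply: fg; near: y; exact: nU.
move=> [df Df]; split => [x Ux|v].
  apply: near_eq_differentiable (df x Ux).
  by near=> y; apply: fg; near: y; exact: nU.
apply: IH (Df v) => x Ux; apply: near_eq_derive.
by near=> y; apply: fg; near: y; exact: nU.
Unshelve. all: by end_near. Qed.

Lemma Ck_cst (V W : normedModType R) k (U : set V) (a : W) : Ck_on k U (cst a : V -> W).
Proof.
elim: k a => [|k IH] a /=; first by move=> x _; exact: cst_continuous.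
split=> [x _|v]; first exact: differentiable_cst.
rewrite (_ : (fun x => _) = cst 0) //; apply/funext => x; exact: derive_cst.
Qed.

Lemma CkD (V W : normedModType R) k (U : set V) (f g : V -> W) : open U ->
  Ck_on k U f -> Ck_on k U g -> Ck_on k U (fun x => f x + g x).
Proof.
move=> oU.
elim: k f g => [|k IH] f g /=.
  by move=> cf cg x Ux; apply: continuousD; [exact: cf|exact: cg].
move=> [df Df] [dg Dg]; split => [x Ux|v].
  by apply: differentiableD; [exact: df|exact: dg].
apply: (@Ck_ext _ _ k U _ _ oU _ (IH _ _ (Df v) (Dg v))) => x Ux /=.
by rewrite -deriveD//; apply: diff_derivable; [exact: df|exact: dg].
Qed.

Lemma CkM (V : normedModType R) k (U : set V) (f g : V -> R^o) : open U ->
  Ck_on k U f -> Ck_on k U g -> Ck_on k U (fun x => f x * g x : R^o).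
Proof.
move=> oU.
elim: k f g => [|k IH] f g.
  by move=> /= cf cg x Ux; apply: continuousM; [exact: cf|exact: cg].
move=> Hf Hg; have [df Df] := Hf; have [dg Dg] := Hg; split => [x Ux|v].
  by apply: differentiableM; [exact: df|exact: dg].
have H := @CkD V R^o k U _ _ oU (IH _ _ (Ck_S Hf) (Dg v)) (IH _ _ (Ck_S Hg) (Df v)).
apply: (@Ck_ext _ _ k U _ _ oU _ H) => x Ux /=.
by rewrite -deriveM//; apply: diff_derivable; [exact: df|exact: dg].
Qed.

Lemma Ck_sum (V W : normedModType R) k (U : set V) (I : Type) (r : seq I) (f : I -> V -> W) :
  open U -> (forall i, Ck_on k U (f i)) -> Ck_on k U (fun x => \sum_(i <- r) f i x).
Proof.
move=> oU H; elim: r => [|i r IH].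
  by apply: (@Ck_ext _ _ k U _ _ oU _ (@Ck_cst V W k U 0)) => x _; rewrite big_nil.
by apply: (@Ck_ext _ _ k U _ _ oU _ (@CkD _ _ k U _ _ oU (H i) IH)) => x _; rewrite big_cons.
Qed.


Lemma differentiable_rvP (V : normedModType R) n (f : V -> 'rV[R]_n) x :
  differentiable f x <-> forall i, differentiable (fun y => f y 0 i : R^o) x.
Proof.
split=> [df i|df].
  exact: (@differentiable_comp R V 'rV[R]_n R^o f (fun M => M 0 i : R^o) x df
    (@differentiable_coord R 1 n (f x) 0 i)).
have -> : f = \sum_(i < n) (fun y => f y 0 i *: delta_mx 0 i).
  by apply/funext => y; rewrite {1}[f y]row_sum_delta fct_sumE.
by apply: differentiable_sum => i; apply: differentiableZl; exact: df.
Qed.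

Lemma derive_coord (V : normedModType R) n (f : V -> 'rV[R]_n) x v i :
  differentiable f x -> ('D_v f x) 0 i = 'D_v (fun y => f y 0 i : R^o) x.
Proof.
by move=> /diff_derivable df; rewrite derive_mx // mxE.
Qed.

Lemma Ck_rvP (V : normedModType R) n k U (f : V -> 'rV[R]_n) : open U ->
  Ck_on k U f <-> forall i, Ck_on k U (fun y => f y 0 i : R^o).
Proof.
move=> oU; elim: k f => [|k IH] f.
  split => /= H; first by move=> i x Ux; exact: (cvg_rvP _ _).1 (H x Ux) i.
  by move=> x Ux; apply: (cvg_rvP _ _).2 => i; exact: H.
split.
  move=> [df Df] i; split => [x /df/differentiable_rvP//|v].
  have := (IH _).1 (Df v) i; apply: Ck_ext => // x Ux.
  by rewrite derive_coord//; exact: df.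
move=> H; have df x : U x -> differentiable f x.
  by move=> Ux; apply/differentiable_rvP => i; exact: (H i).1.
split => // v; apply: (IH _).2 => i; have := (H i).2 v; apply: Ck_ext => // x Ux.
by rewrite derive_coord//; exact: df.
Qed.

Lemma derive_basis (W : normedModType R) n (f : 'rV[R]_n -> W) x v :
  differentiable f x -> 'D_v f x = \sum_(i < n) v 0 i *: 'D_(delta_mx 0 i) f x.
Proof.
move=> df; rewrite deriveE// {1}[v]row_sum_delta linear_sum.
by apply: eq_bigr => i _; rewrite linearZ deriveE.
Qed.

Lemma derive_comp (V W Y : normedModType R) (f : V -> W) (h : W -> Y) x v :
  differentiable f x -> differentiable h (f x) ->
  'D_v (h \o f) x = 'D_('D_v f x) h (f x).
Proof.
move=> df dh; have dc : differentiable (h \o f) x by exact: differentiable_comp.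
by rewrite !deriveE// diff_comp.
Qed.

Lemma Ck_comp_scal (V : normedModType R) n k (U : set V) (O : set 'rV[R]_n)
   (p : V -> 'rV[R]_n) (f : 'rV[R]_n -> R^o) : open U -> open O ->
  (forall x, U x -> O (p x)) -> Ck_on k U p -> Ck_on k O f -> Ck_on k U (f \o p).
Proof.
move=> oU oO UO; elim: k f => [|k IH] f Hp Hf.
  by move=> x Ux; apply: continuous_comp; [exact: Hp|apply: Hf; exact: UO].
have dfp x : U x -> differentiable (f \o p) x.
  by move=> Ux; apply: differentiable_comp; [exact: Hp.1|apply: Hf.1; exact: UO].
split => // v.
have H : Ck_on k U (fun x => \sum_(i < n) (('D_v p x) 0 i * ('D_(delta_mx 0 i) f) (p x) : R^o)).
  apply: Ck_sum => // i; apply: CkM => //.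
    by apply: (Ck_rvP _ _ oU).1; exact: Hp.2.
  by apply: (IH ('D_(delta_mx 0 i) f)); [exact: Ck_S|exact: Hf.2].
apply: (@Ck_ext _ _ k U _ _ oU _ H) => x Ux.
have dfx : differentiable f (p x) by apply: Hf.1; exact: UO.
by rewrite (@derive_comp _ _ _ p f) ?derive_basis//; exact: Hp.1.
Qed.

Lemma Ck_comp (V : normedModType R) n m k (U : set V) (O : set 'rV[R]_n)
   (p : V -> 'rV[R]_n) (f : 'rV[R]_n -> 'rV[R]_m) : open U -> open O ->
  (forall x, U x -> O (p x)) -> Ck_on k U p -> Ck_on k O f -> Ck_on k U (f \o p).
Proof.
move=> oU oO UO Hp Hf; apply/Ck_rvP => // i.
exact: (Ck_comp_scal oU oO UO Hp ((Ck_rvP _ _ oO).1 Hf i)).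
Qed.

End Ck.

(** * Local Lipschitz estimates *)

Section Estimates.
Context {R : realType}.

Lemma near_forall (T : Type) (I : finType) (F : set_system T) {FF : Filter F}
    (P : I -> T -> Prop) :
  (forall i, \forall x \near F, P i x) -> \forall x \near F, forall i, P i x.
Proof.
by move=> H; apply: (@filterS _ F _ _ _ _ (@filter_forall T I P F FF H)) => x Hx i; exact: Hx.
Qed.

Lemma near_ball (V : normedModType R) (x0 : V) (P : V -> Prop) :
  (\forall z \near x0, P z) <-> exists2 r, 0 < r & forall z, `|z - x0| < r -> P z.
Proof.
split=> [/nbhs_ballP[r /= r0 H]|[r r0 H]].
  by exists r => // z zr; apply: H; rewrite -ball_normE /= distrC.
by apply/nbhs_ballP; exists r => // z; rewrite -ball_normE /= distrC; exact: H.
Qed.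

Lemma convex_sub (V : normedModType R) (x y c : V) (t : R) :
  t *: (x - y) + y - c = t *: (x - c) + (1 - t) *: (y - c).
Proof.
have -> : x - y = (x - c) - (y - c) by rewrite opprB addrA subrK.
by rewrite -[LHS]addrA scalerBr scalerBl scale1r -addrA [X in _ + X]addrC.
Qed.

Lemma ball_convex (V : normedModType R) (x y c : V) r (t : R) :
  0 <= t <= 1 -> `|x - c| < r -> `|y - c| < r -> `|t *: (x - y) + y - c| < r.
Proof.
move=> /andP[t0 t1] xr yr.
rewrite convex_sub; apply: le_lt_trans (ler_normD _ _) _; rewrite !normrZ !ger0_norm ?subr_ge0//.
have [->|tn0] := eqVneq t 0; first by rewrite mul0r add0r subr0 mul1r.
have tp : 0 < t by rewrite lt_neqAle eq_sym tn0.
have : t * `|x - c| < t * r by rewrite ltr_pM2l.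
have : (1 - t) * `|y - c| <= (1 - t) * r by rewrite ler_wpM2l ?subr_ge0// ltW.
lra.
Qed.

Lemma is_derive_line (V : normedModType R) n (f : V -> 'rV[R]_n) (v y : V) (t : R) :
  differentiable f (t *: v + y) ->
  is_derive t (1 : R) (fun t => f (t *: v + y)) ('D_v f (t *: v + y)).
Proof.
move=> df.
have dl : is_diff t (fun t : R => t *: v + y) ( *:%R ^~ v).
  have := @is_diffD R R^o V ( *:%R ^~ v) (cst y) ( *:%R ^~ v) 0 t (is_diff_scalel t v) (is_diff_cst y t).
  by rewrite addr0.
have dc : differentiable (fun t : R => f (t *: v + y)) t.
  by apply: (@differentiable_comp R R^o V 'rV[R]_n (fun t : R => t *: v + y) f).
split; first exact: diff_derivable.
have dl' : differentiable (fun t : R => t *: v + y : V) t := ex_diff (is_diff_def := dl).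
have vE : 'D_(1 : R^o) (fun t : R^o => t *: v + y : V) t = v.
  by rewrite deriveE// (diff_val (is_diff_def := dl)) scale1r.
have := @derive_comp R R^o V 'rV[R]_n (fun t : R => t *: v + y) f t 1 dl' df.
by rewrite vE.
Qed.

Lemma mvt_map (V : normedModType R) n (f : V -> 'rV[R]_n) (x y : V) w K :
  (forall t, 0 <= t <= 1 -> differentiable f (t *: (x - y) + y)) ->
  (forall t, 0 <= t <= 1 -> `|'D_(x - y) f (t *: (x - y) + y) - w| <= K) ->
  `|f x - f y - w| <= K.
Proof.
move=> df dK.
have := @mvt_norm R n (fun t => f (t *: (x - y) + y) - t *: w)
  (fun t => 'D_(x - y) f (t *: (x - y) + y) - w) 0 1 K ler01 _ dK.
rewrite !scale1r !scale0r subrK add0r subr0 subr0 mulr1 addrAC; apply=> t t01.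
have h1 := is_derive_line (df t t01).
have h2 : is_derive t (1 : R) (fun t => t *: w) w.
  have dl := is_diff_scalel t w.
  have dl' : differentiable (fun t : R => t *: w) t := ex_diff (is_diff_def := dl).
  split; first exact: diff_derivable.
  by rewrite deriveE// (diff_val (is_diff_def := dl)) scale1r.
exact: is_deriveB.
Qed.

Lemma derive_lin (V W : normedModType R) (f : V -> W) x a u v : differentiable f x ->
  'D_(a *: u + v) f x = a *: 'D_u f x + 'D_v f x.
Proof. by move=> df; rewrite !deriveE// linearP. Qed.

Lemma rv_derive_bound (W : normedModType R) n (f g : 'rV[R]_n -> W) x y v K :
  differentiable f x -> differentiable g y ->
  (forall i, `|'D_(delta_mx 0 i) f x - 'D_(delta_mx 0 i) g y| <= K i) ->
  `|'D_v f x - 'D_v g y| <= (\sum_(i < n) K i) * `|v|.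
Proof.
move=> df dg H; rewrite (derive_basis v df) (derive_basis v dg) -sumrB mulr_suml.
apply: le_trans (ler_norm_sum _ _ _) _; apply: ler_sum => i _.
rewrite -scalerBr normrZ mulrC ler_pM//.
exact: rv_norm_coord.
Qed.

Lemma C1_derive_near (W : normedModType R) n (f : 'rV[R]_n -> W) U x0 e :
  open U -> Ck_on 1 U f -> U x0 -> 0 < e ->
  \forall z \near x0, forall v, `|'D_v f z - 'D_v f x0| <= e * `|v|.
Proof.
move=> oU [df Df] Ux0 e0.
have n1 : (0 : R) < n.+1%:R by [].
have H : \forall z \near x0, forall i : 'I_n,
    `|'D_(delta_mx 0 i) f z - 'D_(delta_mx 0 i) f x0| <= e / n.+1%:R.
  apply: (@near_forall _ _ (nbhs x0) _) => i; have := Df (delta_mx 0 i) x0 Ux0.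
  move/cvgrPdist_le => /(_ (e / n.+1%:R)); rewrite divr_gt0// => /(_ isT).
  by apply: filterS => z; rewrite distrC.
have nU : \forall z \near x0, U z by exact: open_nbhs_nbhs.
near=> z => v.
apply: le_trans (rv_derive_bound v (K := fun=> e / n.+1%:R) _ _ _) _.
- by apply: df; near: z.
- exact: df.
- by near: z.
rewrite ler_wpM2r// sumr_const card_ord -[leLHS]mulr_natl mulrCA ler_piMr ?ltW//.
by rewrite ltr_pdivrMr// mul1r ltr_nat.
Unshelve. all: by end_near. Qed.

Lemma C1_lip n m (f : 'rV[R]_n -> 'rV[R]_m) U x0 :
  open U -> Ck_on 1 U f -> U x0 ->
  exists2 K, 0 <= K & \forall r \near 0^'+, forall z, `|z - x0| < r ->
   [/\ U z, `|f z| <= K, (forall v, `|'D_v f z| <= K * `|v|) &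
     forall y, `|y - x0| < r -> `|f y - f z| <= K * `|y - z|].
Proof.
move=> oU Hf Ux0; have [df Df] := Hf.
have nU : \forall z \near x0, U z by exact: open_nbhs_nbhs.
pose K := `|f x0| + 1 + (\sum_(i < n) `|'D_(delta_mx 0 i) f x0| + 1).
have K0 : 0 <= K by rewrite !addr_ge0// sumr_ge0.
exists K => //.
have h1 := C1_derive_near oU Hf Ux0 ltr01.
have h2 : \forall z \near x0, `|f z| <= `|f x0| + 1.
  have /cvgrPdist_le/(_ 1 ltr01) := Ck_cont Hf Ux0.
  apply: filterS => z zx; rewrite -(subrK (f x0) (f z)).
  by rewrite addrC (le_trans (ler_normD _ _))// lerD2l distrC.
have /near_ball[r0 r00 H] : \forall z \near x0,
   [/\ U z, `|f z| <= K & (forall v, `|'D_v f z| <= K * `|v|)].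
  near=> z; split; first by near: z.
    rewrite (@le_trans _ _ (`|f x0| + 1))//; first by near: z.
    by rewrite lerDl addr_ge0// sumr_ge0.
  move=> v.
  have a1 : `|'D_v f z - 'D_v f x0| <= 1 * `|v| by move: v; near: z.
  have a2 : `|'D_v f x0| <= (\sum_(i < n) `|'D_(delta_mx 0 i) f x0|) * `|v|.
    have h i : `|'D_(delta_mx 0 i) f x0 - 'D_(delta_mx 0 i) (cst 0 : 'rV[R]_n -> 'rV[R]_m) x0| <=
        `|'D_(delta_mx 0 i) f x0| by rewrite derive_cst subr0.
    have := rv_derive_bound v (df _ Ux0) (differentiable_cst _ _) h.
    by rewrite derive_cst subr0.
  rewrite -(subrK ('D_v f x0) ('D_v f z)); apply: le_trans (ler_normD _ _) _.
  rewrite mulrDl (mulrDl _ _ `|v|).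
  have : 0 <= (`|f x0| + 1) * `|v| by rewrite mulr_ge0// addr_ge0.
  lra.
near=> r => z zr.
have rr0 : r <= r0 by near: r; exact: nbhs_right_le.
have zr0 := lt_le_trans zr rr0.
have [Uz fz dfz] := H z zr0; split => // y yr.
have yr0 := lt_le_trans yr rr0.
have := @mvt_map _ _ f y z 0 (K * `|y - z|); rewrite subr0; apply=> t t01.
  by apply: df; have [] := H _ (ball_convex t01 yr0 zr0).
by rewrite subr0; have [_ _ ->] := H _ (ball_convex t01 yr0 zr0).
Unshelve. all: by end_near. Qed.

Lemma C2_lip n m (f : 'rV[R]_n -> 'rV[R]_m) U x0 :
  open U -> Ck_on 2 U f -> U x0 ->
  exists2 K, 0 <= K & \forall r \near 0^'+, forall x y z, `|x - x0| < r ->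
    `|y - x0| < r -> `|z - x0| < r ->
     `|f x - f y - 'D_(x - y) f z| <= K * (`|x - z| + `|y - z|) * `|x - y|.
Proof.
move=> oU Hf Ux0; have [df Df] := Hf.
have /choice[K HK] : forall i : 'I_n, exists K, 0 <= K /\
    \forall r \near 0^'+, forall z, `|z - x0| < r -> forall y, `|y - x0| < r ->
    `|'D_(delta_mx 0 i) f y - 'D_(delta_mx 0 i) f z| <= K * `|y - z|.
  move=> i; have [K K0 H] := C1_lip oU (Df (delta_mx 0 i)) Ux0.
  by exists K; split => //; apply: filterS H => r H z /H[].
have [K' K'0 H'] := C1_lip oU (Ck_S Hf) Ux0.
exists (\sum_(i < n) K i); first by apply: sumr_ge0 => i _; case: (HK i).
have HK' : \forall r \near 0^'+, forall i z, `|z - x0| < r -> forall y, `|y - x0| < r ->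
    `|'D_(delta_mx 0 i) f y - 'D_(delta_mx 0 i) f z| <= K i * `|y - z|.
  by apply: (@near_forall _ _ (0^'+) _) => i; case: (HK i).
near=> r => x y z xr yr zr.
have Ur w : `|w - x0| < r -> U w.
  move: w; near: r; apply: filterS H' => r H w /H[] //.
have B t : 0 <= t <= 1 -> `|t *: (x - y) + y - x0| < r by move=> t01; exact: ball_convex.
apply: mvt_map => t t01; first by apply/df/Ur/B.
have dz : differentiable f z by apply/df/Ur.
have dt : differentiable f (t *: (x - y) + y) by apply/df/Ur/B.
apply: le_trans (rv_derive_bound (x - y) dt dz (K := fun i => K i * `|t *: (x - y) + y - z|) _) _.
  move=> i; have := B t t01; move: (t *: _ + _) => w wr; move: i z zr w wr {dz dt}.
  near: r; apply: filterS HK' => r H i z zr w wr; exact: H.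
rewrite -mulr_suml ler_wpM2r// ler_wpM2l//; first by apply: sumr_ge0 => i _; case: (HK i).
rewrite convex_sub; apply: le_trans (ler_normD _ _) _; rewrite !normrZ.
move/andP: t01 => [t0 t1].
by rewrite !ger0_norm ?subr_ge0// lerD// ler_piMl// gerBl.
Unshelve. all: by end_near. Qed.

End Estimates.

(** * Strict differentiability of curves *)

(* Strict differentiability at every point of an open set is the same as C^1
   there, so one pointwise notion covers both the existence and the continuity
   of the derivative. *)
Definition sder (R : realType) n (f : R -> 'rV[R]_n) (s : R) (v : 'rV[R]_n) :=
  forall e, 0 < e -> exists2 d, 0 < d & forall a b, `|a - s| < d -> `|b - s| < d ->
    `|f a - f b - (a - b) *: v| <= e * `|a - b|.

Section Strict.
Context {R : realType}.

Lemma sder_diff n (f : R -> 'rV[R]_n) s v : sder f s v ->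
  differentiable (f : R^o -> _) s /\ 'D_(1 : R) f s = v.
Proof.
move=> H.
have sx_lin : linear ( *:%R ^~ v : R^o -> 'rV[R]_n).
  by move=> u y z; rewrite scalerDl scalerA.
pose sxlM := GRing.isLinear.Build _ _ _ _ _ sx_lin.
pose sxL : {linear R^o -> 'rV[R]_n} := HB.pack ( *:%R ^~ v : R^o -> 'rV[R]_n) sxlM.
have cL : continuous sxL by exact: scalel_continuous.
have [|df dE] := @diff_epsP R R^o 'rV[R]_n f s sxL cL.
  move=> e e0; have [d d0 Hd] := H e e0; apply/near_ball; exists d => // z zs.
  by apply: Hd => //; rewrite subrr normr0.
by split => //; rewrite deriveE// dE /= scale1r.
Qed.

Lemma sder_near n (f g : R -> 'rV[R]_n) s v : (\near s, f s = g s) -> sder f s v -> sder g s v.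
Proof.
move=> /(@near_ball R R^o)[r r0 fg] H e e0; have [d d0 Hd] := H e e0.
exists (Num.min r d); first by rewrite lt_min r0.
move=> a b; rewrite !lt_min => /andP[ar ad] /andP[br bd].
by rewrite -!fg//; exact: Hd.
Qed.

Lemma sder_continuous_at n (f v : R -> 'rV[R]_n) (O : set R) : open O ->
  (forall s, O s -> sder f s (v s)) -> forall s, O s -> {for s, continuous v}.
Proof.
move=> oO H s Os; apply/cvgrPdist_le => e e0.
have [d d0 Hd] := H s Os e e0.
have [r r0 Hr] : exists2 r, 0 < r & forall z : R^o, `|z - s| < r -> O z.
  by apply/near_ball; exact: open_nbhs_nbhs.
apply/(@near_ball R R^o); exists (Num.min r d); first by rewrite lt_min r0.
move=> t; rewrite lt_min => /andP[tr td].
rewrite distrC; apply/ler_addgt0Pl => k k0.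
have [d' d'0 Hd'] := H t (Hr t tr) k k0.
pose h := Num.min d' (d - `|t - s|) / 2.
have m0 : 0 < Num.min d' (d - `|t - s|) by rewrite lt_min d'0 subr_gt0.
have h0 : 0 < h by rewrite divr_gt0.
have hm : h < Num.min d' (d - `|t - s|) by rewrite /h; lra.
move: hm; rewrite lt_min => /andP[hd' hd].
have thE : t + h - t = h by rewrite addrC addKr.
have a1 := Hd' (t + h) t; rewrite thE subrr normr0 (gtr0_norm h0) in a1.
have {}a1 := a1 hd' d'0.
have a2 : `|f (t + h) - f t - (t + h - t) *: v s| <= e * `|t + h - t|.
  apply: Hd => //; rewrite (addrAC t h) (le_lt_trans (ler_normD _ _))// (gtr0_norm h0).
  lra.
rewrite thE (gtr0_norm h0) in a2.
have : h * `|v t - v s| <= h * (k + e).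
  rewrite -{1}(gtr0_norm h0) -normrZ mulrDr mulrC (mulrC h e).
  have -> : h *: (v t - v s) = (f (t + h) - f t - h *: v s) - (f (t + h) - f t - h *: v t).
    by move: (f (t + h) - f t) => A; rewrite opprB [RHS]addrC addrA subrK scalerBr.
  by apply: le_trans (ler_normB _ _) _; rewrite addrC lerD.
by rewrite ler_pM2l.
Qed.

Lemma C1_sder n (f : R -> 'rV[R]_n) (O : set R^o) : open O ->
  Ck_on 1 O (f : R^o -> _) -> forall s, O s -> sder f s ('D_(1 : R) f s).
Proof.
move=> oO [df Df] s Os e e0.
have /cvgrPdist_le/(_ e e0) := Df (1 : R) s Os.
move=> /(@near_ball R R^o)[r r0 H].
have [r' r'0 Hr'] : exists2 r, 0 < r & forall z : R^o, `|z - s| < r -> O z.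
  by apply/near_ball; exact: open_nbhs_nbhs.
exists (Num.min r r'); first by rewrite lt_min r0.
move=> a b ar br.
have B t : 0 <= t <= 1 -> O (t *: (a - b : R^o) + b) /\
   `|'D_(1 : R) f s - 'D_(1 : R) f (t *: (a - b : R^o) + b)| <= e.
  move=> t01; have := @ball_convex R R^o a b s _ t t01 ar br.
  by rewrite lt_min => /andP[h1 h2]; split; [exact: Hr'|exact: H].
apply: (@mvt_map R R^o n f) => t /B[Ot Ht]; first exact: df.
have D1 x : O x -> 'D_(a - b : R^o) f x = (a - b) *: 'D_(1 : R^o) f x.
  by move=> Ox; rewrite !deriveE//; [rewrite -linearZ/= [X in _ = 'd _ _ X]mulr1|exact: df|exact: df].
have -> : 'D_(a - b : R^o) f (t *: (a - b : R^o) + b) - (a - b) *: 'D_(1 : R) f s =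
   (a - b) *: ('D_(1 : R) f (t *: (a - b : R^o) + b) - 'D_(1 : R) f s).
  by rewrite (D1 _ Ot) -scalerBr.
have gen (k : R) (u w : 'rV[R]_n) : `|u - w| <= e -> `|k *: (w - u)| <= e * `|k|.
  by move=> uw; rewrite normrZ [leRHS]mulrC; apply: ler_wpM2l => //; rewrite distrC.
exact: gen Ht.
Qed.

Lemma sder_C1 n (f v : R -> 'rV[R]_n) (O : set R^o) : open O ->
  (forall s, O s -> sder f s (v s)) -> Ck_on 1 O (f : R^o -> _).
Proof.
move=> oO H; split => [s Os|u]; first exact: (sder_diff (H s Os)).1.
have cv : Ck_on 0 O (fun s : R^o => u *: v s).
  by move=> s Os; apply: cvgZl_tmp; apply: (sder_continuous_at oO H Os).
apply: (Ck_ext oO _ cv) => s Os /=.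
have [df <-] := sder_diff (H s Os).
by rewrite !deriveE// -linearZ/= [X in 'd _ _ X]mulr1.
Qed.

Lemma sder_comp n m (f : R -> 'rV[R]_n) s v (h : 'rV[R]_n -> 'rV[R]_m) U :
  open U -> Ck_on 1 U h -> U (f s) -> sder f s v -> sder (h \o f) s ('D_v h (f s)).
Proof.
move=> oU Hh Ufs Hf e e0.
have [K K0 Klip] := C1_lip oU Hh Ufs.
pose e1 := e / (2 * (`|v| + 1)).
have v1 : 0 < `|v| + 1 by rewrite ltr_wpDl.
have e10 : 0 < e1 by rewrite divr_gt0// mulr_gt0.
have := C1_derive_near oU Hh Ufs e10.
move=> /near_ball[r r0 Hr].
have [r' r'0 [r'r Hr']] : exists2 r', 0 < r' & r' <= r /\ forall z, `|z - f s| < r' ->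
   U z /\ forall v, `|'D_v h z| <= K * `|v|.
  have : \forall r' \near 0^'+, 0 < r' /\ (r' <= r /\ forall z, `|z - f s| < r' ->
   U z /\ forall v, `|'D_v h z| <= K * `|v|).
    near=> r'; split; first by [].
    split; first by near: r'; exact: nbhs_right_le.
    by near: r'; apply: filterS Klip => r' H z /H[].
  by move=> /filter_ex[r' [? ?]]; exists r'.
pose e2 := Num.min 1 (e / (2 * (K + 1))).
have K1 : 0 < K + 1 by rewrite ltr_wpDl.
have e20 : 0 < e2 by rewrite lt_min ltr01 divr_gt0// mulr_gt0.
have [d d0 Hd] := Hf e2 e20.
have e21 : e2 <= 1 by rewrite ge_min lexx.
have e2K : K * e2 <= e / 2.
  have : e2 <= e / (2 * (K + 1)) by rewrite ge_min lexx orbT.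
  rewrite ler_pdivlMr ?mulr_gt0// => h2; nra.
have fl a b : `|a - s| < d -> `|b - s| < d -> `|f a - f b| <= (`|v| + 1) * `|a - b|.
  move=> ad bd; have := Hd a b ad bd.
  have := ler_normD (f a - f b - (a - b) *: v) ((a - b) *: v); rewrite subrK normrZ.
  have : e2 * `|a - b| <= 1 * `|a - b| by rewrite ler_wpM2r.
  lra.
pose d1 := Num.min d (r' / (`|v| + 1)).
have d10 : 0 < d1 by rewrite lt_min d0 divr_gt0.
have fr a : `|a - s| < d1 -> `|f a - f s| < r'.
  rewrite lt_min => /andP[ad]; rewrite ltr_pdivlMr// mulrC => h1.
  by apply: le_lt_trans h1; apply: fl => //; rewrite subrr normr0.
exists d1 => // a b ad1 bd1.
have ar := fr a ad1; have br := fr b bd1.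
have [ad bd] : `|a - s| < d /\ `|b - s| < d.
  by move: ad1 bd1; rewrite !lt_min => /andP[? _] /andP[].
have dfs : differentiable h (f s) by apply: Hh.1.
have E1 : `|h (f a) - h (f b) - 'D_(f a - f b) h (f s)| <= e1 * `|f a - f b|.
  apply: mvt_map => t t01; have B := ball_convex t01 ar br.
    by apply: Hh.1; exact: (Hr' _ B).1.
  by apply: Hr; exact: lt_le_trans B r'r.
have E2 : `|'D_(f a - f b - (a - b) *: v) h (f s)| <= K * (e2 * `|a - b|).
  have [_ H2] : U (f s) /\ forall v, `|'D_v h (f s)| <= K * `|v|.
    by apply: Hr'; rewrite subrr normr0.
  by apply: le_trans (H2 _) _; rewrite ler_wpM2l//; exact: Hd.
have -> : (h \o f) a - (h \o f) b - (a - b) *: 'D_v h (f s) =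
   (h (f a) - h (f b) - 'D_(f a - f b) h (f s)) + 'D_(f a - f b - (a - b) *: v) h (f s).
  have -> : f a - f b - (a - b) *: v = (- (a - b)) *: v + (f a - f b) by rewrite addrC scaleNr.
  by rewrite derive_lin// scaleNr [X in _ = _ + X]addrC addrA subrK.
apply: le_trans (ler_normD _ _) _.
have E3 : e1 * `|f a - f b| <= e / 2 * `|a - b|.
  apply: le_trans (ler_wpM2l (ltW e10) (fl a b ad bd)) _.
  by rewrite mulrA ler_wpM2r// /e1 invfM mulrA mulfVK ?gt_eqF.
have : K * (e2 * `|a - b|) <= e / 2 * `|a - b| by rewrite mulrA ler_wpM2r.
lra.
Unshelve. all: by end_near. Qed.

Lemma sder_lip n (f : R -> 'rV[R]_n) s v : sder f s v ->
  exists2 d, 0 < d & forall a b, `|a - s| < d -> `|b - s| < d ->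
     `|f a - f b| <= (`|v| + 1) * `|a - b|.
Proof.
move=> /(_ 1 ltr01)[d d0 Hd]; exists d => // a b ad bd; have := Hd a b ad bd.
have := ler_normD (f a - f b - (a - b) *: v) ((a - b) *: v); rewrite subrK normrZ.
lra.
Qed.

End Strict.

(** * Charts and coordinate fields *)

Definition trans (R : realType) n (M : smoothManifold R n) (c c' : chart R n M)
    (p : M) (v : 'rV[R]_n) : 'rV[R]_n := 'D_v (c' \o chart_inv c) (c p).

Definition coord_field (R : realType) n (M : smoothManifold R n) (c : chart R n M)
    (v : 'rV[R]_n) : vfield M := fun p => trans c (chart_at p) p v.

Section Charts.
Context {R : realType} {n : nat} {M : smoothManifold R n}.
Implicit Types (c : chart R n M) (p : M) (v : 'rV[R]_n).

Lemma chart_near c p (U : set M) : chart_dom c p -> open U -> U p ->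
  \forall y \near c p, [/\ U (chart_inv c y), chart_dom c (chart_inv c y) &
     c (chart_inv c y) = y].
Proof.
move=> cp oU Up.
have ci : (c @` chart_dom c) (c p) by exists p.
have h1 : \forall y \near c p, (c @` chart_dom c) y.
  by apply: open_nbhs_nbhs; split => //; exact: chart_img_open.
have h2 : \forall y \near c p, U (chart_inv c y).
  apply: (chart_inv_continuous ci).
  by rewrite chart_mapK//; apply: open_nbhs_nbhs.
near=> y; have [q cq qE] : (c @` chart_dom c) y by near: y.
have Uy : U (chart_inv c y) by near: y.
by split => //; rewrite -qE chart_mapK.
Unshelve. all: by end_near. Qed.

Lemma chart_img_openI c (U : set M) : open U -> open (c @` (U `&` chart_dom c)).
Proof.
move=> oU; rewrite openE => _ [p [Up cp] <-].
have := chart_near cp oU Up; apply: filterS => y [Uy cy yE].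
by exists (chart_inv c y).
Qed.

Lemma trans_smooth c c' : atlas c -> atlas c' ->
  Cinf_on (c @` (chart_dom c' `&` chart_dom c)) (c' \o chart_inv c).
Proof. by move=> ac ac'; rewrite setIC; exact: atlas_smooth. Qed.

Lemma trans_diff c c' p : atlas c -> atlas c' -> chart_dom c p -> chart_dom c' p ->
  differentiable (c' \o chart_inv c) (c p).
Proof.
move=> ac ac' cp cp'; have [d _] := trans_smooth ac ac' 1.
by apply: d; exists p.
Qed.

Lemma trans_lin c c' p a u v : atlas c -> atlas c' -> chart_dom c p -> chart_dom c' p ->
  trans c c' p (a *: u + v) = a *: trans c c' p u + trans c c' p v.
Proof. by move=> *; rewrite /trans derive_lin//; exact: trans_diff. Qed.

Lemma trans_comp (W : normedModType R) c c' p v (f : M -> W) :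
  atlas c -> atlas c' -> chart_dom c p -> chart_dom c' p ->
  differentiable (f \o chart_inv c') (c' p) ->
  'D_v (f \o chart_inv c) (c p) = 'D_(trans c c' p v) (f \o chart_inv c') (c' p).
Proof.
move=> ac ac' cp cp' df.
transitivity ('D_v ((f \o chart_inv c') \o (c' \o chart_inv c)) (c p)).
  apply: near_eq_derive.
  have := chart_near cp (chart_dom_open c') cp'; apply: filterS => y [cy _ _].
  by rewrite /= chart_mapK.
have E : (c' \o chart_inv c) (c p) = c' p by rewrite /= chart_mapK.
rewrite derive_comp ?E//; first exact: trans_diff.
Qed.

Lemma trans_cocycle c c' c'' p v : atlas c -> atlas c' -> atlas c'' ->
  chart_dom c p -> chart_dom c' p -> chart_dom c'' p ->
  trans c' c'' p (trans c c' p v) = trans c c'' p v.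
Proof.
move=> ac ac' ac'' cp cp' cp''; rewrite {1 3}/trans.
by rewrite [RHS](@trans_comp _ c c')//; exact: trans_diff.
Qed.

Lemma trans_id c p v : chart_dom c p -> trans c c p v = v.
Proof.
move=> cp; rewrite /trans -[RHS](@derive_id R _ (c p) v).
apply: near_eq_derive; have := chart_near cp (chart_dom_open c) cp.
by apply: filterS => y [].
Qed.

Lemma tangent_coordE c p (w : tangent p) : tangent_coord c w = trans (chart_at p) c p w.
Proof. by []. Qed.

Lemma tangent_coordK c p (w : tangent p) : atlas c -> chart_dom c p ->
  coord_field c (tangent_coord c w) p = w.
Proof.
move=> ac cp; rewrite /coord_field tangent_coordE trans_cocycle ?trans_id//;
  by [exact: chart_at_dom|exact: chart_at_atlas].
Qed.

Lemma coord_fieldK c p v : atlas c -> chart_dom c p ->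
  tangent_coord c (coord_field c v p) = v.
Proof.
move=> ac cp; rewrite tangent_coordE /coord_field trans_cocycle ?trans_id//;
  by [exact: chart_at_dom|exact: chart_at_atlas].
Qed.

Lemma coord_field_lin c p a u v : atlas c -> chart_dom c p ->
  coord_field c (a *: u + v) p = a *: coord_field c u p + coord_field c v p.
Proof.
move=> ac cp; apply: trans_lin => //; by [exact: chart_at_dom|exact: chart_at_atlas].
Qed.

Lemma coord_fieldN c p v : atlas c -> chart_dom c p ->
  coord_field c (- v) p = - coord_field c v p.
Proof.
move=> ac cp; have ap := chart_at_atlas p; have dp := chart_at_dom p.
have df := trans_diff ac ap cp dp.
by rewrite /coord_field /trans !deriveE// linearN.
Qed.

Lemma tangent_coord_trans c c' p (w : tangent p) : atlas c -> atlas c' ->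
  chart_dom c p -> chart_dom c' p ->
  trans c c' p (tangent_coord c w) = tangent_coord c' w.
Proof.
move=> ac ac' cp cp'; rewrite !tangent_coordE trans_cocycle//;
  by [exact: chart_at_dom|exact: chart_at_atlas].
Qed.

Lemma coord_field_smooth c v : atlas c -> smooth_vfield (chart_dom c) (coord_field c v).
Proof.
move=> ac c' ac' k.
set U := c' @` _.
have oU : open U by apply: chart_img_openI; exact: chart_dom_open.
pose O := c @` (chart_dom c' `&` chart_dom c).
have oO : open O by apply: chart_img_openI; exact: chart_dom_open.
have H := @Ck_comp R 'rV[R]_n n n k U O (c \o chart_inv c') ('D_v (c' \o chart_inv c)) oU oO.
apply: (Ck_ext oU _ (H _ _ _)).
- move=> _ [p [cp cp'] <-]; rewrite /= (chart_mapK cp'); symmetry; apply: trans_cocycle => //;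
    by [exact: chart_at_dom|exact: chart_at_atlas].
- by move=> _ [p [cp cp'] <-]; exists p => //=; rewrite chart_mapK.
- by apply: trans_smooth.
- exact: (trans_smooth ac ac' k.+1).2.
Qed.

Lemma coord_smooth c i : atlas c -> smooth_fun (chart_dom c) (fun p => c p 0 i).
Proof.
move=> ac c' ac' k.
have oU : open (c' @` (chart_dom c `&` chart_dom c')) by apply: chart_img_openI; exact: chart_dom_open.
exact: (Ck_rvP _ _ oU).1 (trans_smooth ac' ac k) i.
Qed.

Lemma tangent_derE c p (w : tangent p) (f : M -> R) : atlas c -> chart_dom c p ->
  differentiable (f \o chart_inv c : 'rV[R]_n -> R^o) (c p) ->
  tangent_der w f = 'D_(tangent_coord c w) (f \o chart_inv c : 'rV[R]_n -> R^o) (c p).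
Proof.
move=> ac cp df; rewrite /tangent_der tangent_coordE.
by apply: (@trans_comp R^o) => //; [exact: chart_at_atlas|exact: chart_at_dom].
Qed.

Lemma tangent_der_near c p (w : tangent p) (f : M -> R) (h : 'rV[R]_n -> R^o) :
  atlas c -> chart_dom c p -> (forall q, chart_dom c q -> f q = h (c q)) ->
  differentiable h (c p) ->
  tangent_der w f = 'D_(tangent_coord c w) h (c p).
Proof.
move=> ac cp fh dh.
have E : \forall y \near c p, h y = (f \o chart_inv c : 'rV[R]_n -> R^o) y.
  have := chart_near cp (chart_dom_open c) cp; apply: filterS => y [cy _ yE].
  by rewrite /= fh// yE.
have df : differentiable (f \o chart_inv c : 'rV[R]_n -> R^o) (c p).
  exact: near_eq_differentiable dh.
rewrite (tangent_derE _ ac cp df).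
by apply: near_eq_derive; apply: filterS E => y ->.
Qed.

Lemma tangent_der_coord c p (w : tangent p) i : atlas c -> chart_dom c p ->
  tangent_der w (fun p => c p 0 i) = tangent_coord c w 0 i.
Proof.
move=> ac cp.
have dc : differentiable (fun y : 'rV[R]_n => y 0 i : R^o) (c p).
  exact: differentiable_coord.
rewrite (@tangent_der_near c p w _ (fun y => y 0 i : R^o))//.
rewrite -(@derive_coord R _ n id (c p)) ?derive_id//.
Qed.

Definition local_rep c (X : vfield M) (x : 'rV[R]_n) : 'rV[R]_n :=
  tangent_coord c (X (chart_inv c x)).

Lemma local_rep_smooth c X : atlas c -> smooth_vfield [set: M] X ->
  Cinf_on (c @` chart_dom c) (local_rep c X).
Proof. by move=> ac sX k; have := sX c ac k; rewrite setTI. Qed.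

Definition local_metric (g : riemannian_metric M) c (v w : 'rV[R]_n) (x : 'rV[R]_n) : R^o :=
  g (chart_inv c x) (coord_field c v (chart_inv c x)) (coord_field c w (chart_inv c x)).

Lemma local_metric_smooth g c v w : atlas c ->
   Cinf_on (c @` chart_dom c) (local_metric g c v w).
Proof.
move=> ac k.
have := @inner_smooth R n M g (chart_dom c) _ _ (chart_dom_open c) (coord_field_smooth v ac) (coord_field_smooth w ac) c ac k.
by rewrite setIid.
Qed.

(* This is (L_X g)(V, V) = 2 g(nabla_V X, V) for a constant coordinate field V,
   where L_X V = [X, V] has components - D_V X. *)
Lemma lie_identity (g : riemannian_metric M) (nabla : affine_connection M) (X : vfield M) c p v :
  levi_civita g nabla -> smooth_vfield [set: M] X -> atlas c -> chart_dom c p ->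
  'D_(local_rep c X (c p)) (local_metric g c v v) (c p) +
   2 * local_metric g c ('D_v (local_rep c X) (c p)) v (c p) =
  2 * g p (nabla p (coord_field c v p) X) (coord_field c v p).
Proof.
move=> [tf mc] sX ac cp.
have oc := chart_dom_open c.
have sE := coord_field_smooth v ac.
have sX' : smooth_vfield (chart_dom c) X.
  move=> c' ac' k; apply: Ck_sub (sX c' ac' k).
  by move=> _ [q [_ cq] <-]; exists q.
have cpi : (c @` chart_dom c) (c p) by exists p.
have dF : differentiable (local_rep c X) (c p).
  exact: (local_rep_smooth ac sX 1).1.
have dG : differentiable (local_metric g c v v) (c p).
  exact: (local_metric_smooth g v v ac 1).1.
have coordX : tangent_coord c (X p) = local_rep c X (c p).
  by rewrite /local_rep chart_mapK.
have H1 := mc (chart_dom c) (coord_field c v) (coord_field c v) p (X p) oc cp sE sE.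
rewrite (tangent_der_near (h := local_metric g c v v) _ ac cp _ dG) in H1; last first.
  by move=> q cq; rewrite /local_metric chart_mapK.
rewrite coordX [X in _ = _ + X]inner_sym in H1.
set W := nabla p (X p) (coord_field c v) - nabla p (coord_field c v p) X.
have HW : tangent_coord c (W : tangent p) = - 'D_v (local_rep c X) (c p).
  apply/rowP => i; rewrite -(tangent_der_coord _ _ ac cp).
  rewrite (tf (chart_dom c) X (coord_field c v) _ p oc cp sX' sE (coord_smooth i ac)).
  rewrite (tangent_der_near (h := cst (v 0 i)) _ ac cp); last 2 first.
  - by move=> q cq; rewrite tangent_der_coord// coord_fieldK.
  - exact: differentiable_cst.
  rewrite derive_cst sub0r.
  rewrite (tangent_der_near (h := fun y => local_rep c X y 0 i) _ ac cp).
  - by rewrite (coord_fieldK _ ac cp) mxE -derive_coord.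
  - by move=> q cq; rewrite (tangent_der_coord _ _ ac cq) /local_rep (chart_mapK cq).
  - exact: (differentiable_rvP _ _).1.
have WE : W = - coord_field c ('D_v (local_rep c X) (c p)) p.
  by rewrite -(tangent_coordK W ac cp) HW (coord_fieldN _ ac cp).
have NE : nabla p (X p) (coord_field c v) = (-1) *: coord_field c ('D_v (local_rep c X) (c p)) p + nabla p (coord_field c v p) X.
  by rewrite scaleN1r -WE /W subrK.
rewrite H1 NE inner_linear /local_metric chart_mapK//.
lra.
Qed.

End Charts.

(** * Time-dependent quadratic forms *)

Section Metric.
Context {R : realType} {n : nat}.
Variable G : 'rV[R]_n -> 'rV[R]_n -> 'rV[R]_n -> R^o.
Hypothesis Gsym : forall v w x, G v w x = G w v x.
Hypothesis Glin : forall a u v w x, G (a *: u + v) w x = a * G u w x + G v w x.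

Lemma metric0l w x : G 0 w x = 0.
Proof.
have := Glin 1 0 0 w x; rewrite scaler0 addr0 mul1r => h.
by apply: (@addrI _ (G 0 w x)); rewrite addr0 -h.
Qed.

Lemma metric_suml (I : Type) (r : seq I) (a : I -> R) (v : I -> 'rV[R]_n) w x :
  G (\sum_(i <- r) a i *: v i) w x = \sum_(i <- r) a i * G (v i) w x.
Proof.
elim: r => [|i r IH]; first by rewrite !big_nil metric0l.
by rewrite !big_cons Glin IH.
Qed.

Lemma metric_expand v w x : G v w x =
  \sum_(i < n) \sum_(j < n) (v 0 i * w 0 j) * G (delta_mx 0 i) (delta_mx 0 j) x.
Proof.
rewrite {1}[v]row_sum_delta metric_suml; apply: eq_bigr => i _.
rewrite Gsym {1}[w]row_sum_delta metric_suml big_distrr /=.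
by apply: eq_bigr => j _; rewrite mulrA Gsym.
Qed.

Lemma metric_cvg (T : Type) (F : set_system T) {FF : Filter F}
    (v : T -> 'rV[R]_n) (x : T -> 'rV[R]_n) v0 x0 :
  v t @[t --> F] --> v0 -> x t @[t --> F] --> x0 ->
  (forall i j, {for x0, continuous (G (delta_mx 0 i) (delta_mx 0 j))}) ->
  G (v t) (v t) (x t) @[t --> F] --> G v0 v0 x0.
Proof.
move=> /cvg_rvP vc xc Gc; rewrite metric_expand.
under eq_cvg => t do rewrite metric_expand.
apply: (@cvg_sumv R R^o) => i; apply: (@cvg_sumv R R^o) => j.
apply: cvgM; first by apply: cvgM; exact: vc.
apply: (cvg_comp _ _ xc); exact: Gc.
Qed.

Lemma metric_is_derive (D y : R -> 'rV[R]_n) D' y' t :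
  is_derive t (1 : R) D D' -> is_derive t (1 : R) y y' ->
  (forall v w, differentiable (G v w) (y t)) ->
  is_derive t (1 : R) (fun t => G (D t) (D t) (y t) : R)
    (2 * G D' (D t) (y t) + 'D_y' (G (D t) (D t)) (y t)).
Proof.
move=> /is_derive_rvP dD dy dG.
have dGy i j : is_derive t (1 : R) (fun t => G (delta_mx 0 i) (delta_mx 0 j) (y t) : R)
   ('D_y' (G (delta_mx 0 i) (delta_mx 0 j)) (y t)).
  have [/derivable1_diffP dy1 <-] := dy.
  have dc := differentiable_comp dy1 (dG (delta_mx 0 i) (delta_mx 0 j)).
  split; first exact: diff_derivable.
  exact: (derive_comp _ dy1 (dG (delta_mx 0 i) (delta_mx 0 j))).
have h : is_derive t (1 : R) (\sum_(i < n) \sum_(j < n)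
   ((fun t => D t 0 i : R) * (fun t => D t 0 j : R)) *
   (fun t => G (delta_mx 0 i) (delta_mx 0 j) (y t) : R))
  (\sum_(i < n) \sum_(j < n) ((D t 0 i * D t 0 j) * 'D_y' (G (delta_mx 0 i) (delta_mx 0 j)) (y t) +
     G (delta_mx 0 i) (delta_mx 0 j) (y t) * (D t 0 i * D' 0 j + D t 0 j * D' 0 i))).
  apply: is_derive_sum => i; apply: is_derive_sum => j.
  have h1 := is_deriveM (dD i) (dD j).
  exact: (is_deriveM h1 (dGy i j)).
have -> : (fun t => G (D t) (D t) (y t) : R) = (\sum_(i < n) \sum_(j < n)
   ((fun t => D t 0 i : R) * (fun t => D t 0 j : R)) *
   (fun t => G (delta_mx 0 i) (delta_mx 0 j) (y t) : R)).
  apply/funext => s; rewrite metric_expand fct_sumE; apply: eq_bigr => i _.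
  by rewrite fct_sumE.
apply: (is_derive_eq h).
have -> : 'D_y' (G (D t) (D t)) (y t) = \sum_(i < n) \sum_(j < n)
   (D t 0 i * D t 0 j) * 'D_y' (G (delta_mx 0 i) (delta_mx 0 j)) (y t).
  have -> : G (D t) (D t) = \sum_(i < n) \sum_(j < n)
      (D t 0 i * D t 0 j) *: (G (delta_mx 0 i) (delta_mx 0 j)).
    apply/funext => s; rewrite metric_expand fct_sumE; apply: eq_bigr => i _.
    by rewrite fct_sumE.
  rewrite derive_sum => [|i]; last first.
    by apply: derivable_sum => j; apply: derivableZ; apply: diff_derivable.
  apply: eq_bigr => i _; rewrite derive_sum => [|j]; last first.
    by apply: derivableZ; apply: diff_derivable.
  by apply: eq_bigr => j _; rewrite deriveZ//; exact: diff_derivable.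
have -> : 2 * G D' (D t) (y t) = G (D t) D' (y t) + G D' (D t) (y t).
  by rewrite (Gsym (D t)) mulr_natl.
rewrite !(metric_expand D') !(metric_expand _ D') -!big_split/=; apply: eq_bigr => i _.
rewrite -!big_split/=; apply: eq_bigr => j _; ring.
Qed.

Lemma gronwall (q q' : R -> R) (a b c k : R) : a <= b -> 0 <= c -> 0 <= k ->
  (forall t, a <= t <= b -> is_derive t (1 : R) q (q' t)) ->
  (forall t, a <= t <= b -> q' t <= c * q t + k) ->
  q b <= expR (c * (b - a)) * (q a + k * (b - a)).
Proof.
move=> ab c0 k0 dq qle.
pose h t := expR (- c * (t - a)) * q t - k * (t - a).
pose h' t := (expR (- c * (t - a)) * q' t + q t * (expR (- c * (t - a)) * (- c))) - k.
have dh t : a <= t <= b -> is_derive t (1 : R) h (h' t).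
  move=> tab; have dqt := dq t tab.
  have d1 : is_derive t (1 : R) (fun t => t - a : R) 1.
    by have := @is_deriveB R R^o R^o id (cst a) t 1 1 0 _ _; rewrite subr0; apply.
  have d2 (m : R) : is_derive t (1 : R) (fun t => m * (t - a) : R) m.
    by have := @is_deriveZ R R^o R^o _ m t 1 _ d1; rewrite [m *: _]mulr1.
  have d3 : is_derive t (1 : R) (fun t => expR (- c * (t - a)) : R) (expR (- c * (t - a)) * (- c)).
    have := @is_derive1_comp R expR _ t _ _ (is_derive_expR _) (d2 (- c)); exact.
  have d4 := is_deriveM d3 dqt.
  exact: (is_deriveB d4 (d2 k)).
have hc : {within `[a, b], continuous h}.
  by apply: derivable_within_continuous => x; rewrite in_itv/= => /dh[].
have dh' t : t \in `]a, b[ -> is_derive t (1 : R) h (h' t).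
  by rewrite in_itv/= => /andP[? ?]; apply: dh; rewrite !ltW.
have [x] := MVT_segment ab dh' hc; rewrite in_itv/= => xab hE.
have hle : h b <= h a.
  rewrite -subr_le0 hE; apply: mulr_le0_ge0; last by rewrite subr_ge0.
  rewrite /h'; set e := expR _.
  have e0 : 0 <= e by exact: expR_ge0.
  have e1 : e <= 1.
    by rewrite -expR0 ler_expR mulNr oppr_le0 mulr_ge0//; lra.
  have := qle x xab => h1.
  have : e * (q' x - c * q x) <= e * k by rewrite ler_wpM2l//; lra.
  have : e * k <= 1 * k by rewrite ler_wpM2r.
  lra.
move: hle; rewrite /h subrr !mulr0 expR0 mul1r subr0 => hle.
have hle' : expR (- c * (b - a)) * q b <= q a + k * (b - a) by lra.
rewrite mulNr expRN in hle'.
by rewrite -ler_pdivrMl ?expR_gt0.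
Qed.

End Metric.

(** * Differentiability in the initial condition *)

(* Quotients with s1 = s2 are 0, as 0^-1 = 0. *)
Definition divdiff (R : realType) (n : nat) (y : R -> R -> 'rV[R]_n) (s1 s2 t : R) :=
  (s1 - s2)^-1 *: (y s1 t - y s2 t).

Section Propagation.
Context {R : realType} {n : nat}.
Variables (F : 'rV[R]_n -> 'rV[R]_n) (x0 : 'rV[R]_n) (r K a b : R).
Hypothesis K0 : 0 <= K.
Hypothesis ab : a <= b.
Hypothesis Kab : K * (b - a) <= 2^-1.
Hypothesis HF : forall z, `|z - x0| < r ->
  [/\ differentiable F z, (forall v, `|'D_v F z| <= K * `|v|) &
      forall y, `|y - x0| < r -> `|F y - F z| <= K * `|y - z|].
Hypothesis HF2 : forall x y z, `|x - x0| < r -> `|y - x0| < r -> `|z - x0| < r ->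
   `|F x - F y - 'D_(x - y) F z| <= K * (`|x - z| + `|y - z|) * `|x - y|.

Definition sol (y : R -> 'rV[R]_n) := forall t, a <= t <= b ->
  is_derive t (1 : R) y (F (y t)) /\ `|y t - x0| < r.

Lemma sol_lip y1 y2 : sol y1 -> sol y2 -> forall t, a <= t <= b ->
  `|y1 t - y2 t| <= 2 * `|y1 a - y2 a|.
Proof.
move=> s1 s2 t tab.
have := @short_time_bound R n (fun t => y1 t - y2 t) (fun t => F (y1 t) - F (y2 t)) a b K 0
  ab K0 Kab (lexx _) _ _ t tab.
rewrite mul0r addr0; apply => u uab.
  exact: is_deriveB (s1 u uab).1 (s2 u uab).1.
have [_ _ H] := HF (s2 u uab).2.
by rewrite addr0; apply: H; exact: (s1 u uab).2.
Qed.

Variables (y : R -> R -> 'rV[R]_n) (s d : R) (v : 'rV[R]_n).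
Hypothesis d0 : 0 < d.
Hypothesis ysol : forall s', `|s' - s| < d -> sol (y s').
Hypothesis yv : sder (fun s' => y s' a) s v.

Local Notation D := (divdiff y).
Local Notation M := (2 * (`|v| + 1)).

Lemma divdiff_is_derive s1 s2 t : `|s1 - s| < d -> `|s2 - s| < d -> a <= t <= b ->
  is_derive t (1 : R) (D s1 s2) ((s1 - s2)^-1 *: (F (y s1 t) - F (y s2 t))).
Proof.
move=> h1 h2 tab; apply: is_deriveZ; apply: is_deriveB.
  exact: (ysol h1 tab).1.
exact: (ysol h2 tab).1.
Qed.

Lemma traj_lip : exists2 d1, 0 < d1 <= d & forall s1 s2, `|s1 - s| < d1 -> `|s2 - s| < d1 ->
  forall t, a <= t <= b -> `|y s1 t - y s2 t| <= M * `|s1 - s2| /\ `|D s1 s2 t| <= M.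
Proof.
have [d1 d10 Hd1] := sder_lip yv.
have m0 : 0 < Num.min d d1 by rewrite lt_min d0.
exists (Num.min d d1); first by rewrite m0 ge_min lexx.
move=> s1 s2; rewrite !lt_min => /andP[h1 h1'] /andP[h2 h2'] t tab.
have E : `|y s1 t - y s2 t| <= M * `|s1 - s2|.
  apply: le_trans (sol_lip (ysol h1) (ysol h2) tab) _.
  by rewrite -mulrA ler_wpM2l//; exact: Hd1.
split => //; rewrite /divdiff.
have [->|sn] := eqVneq s1 s2.
  by rewrite (subrr s2) invr0 scale0r normr0 mulr_ge0// addr_ge0.
rewrite normrZ normfV.
by rewrite mulrC ler_pdivrMr// normr_gt0 subr_eq0.
Qed.

Lemma divdiff_err s1 s2 t : `|s1 - s| < d -> `|s2 - s| < d -> a <= t <= b ->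
  `|(s1 - s2)^-1 *: (F (y s1 t) - F (y s2 t)) - 'D_(D s1 s2 t) F (y s t)| <=
   K * (`|y s1 t - y s t| + `|y s2 t - y s t|) * `|D s1 s2 t|.
Proof.
move=> h1 h2 tab.
have h0 : `|s - s| < d by rewrite subrr normr0.
have [df _ _] := HF (ysol h0 tab).2.
have H := HF2 (ysol h1 tab).2 (ysol h2 tab).2 (ysol h0 tab).2.
have -> : 'D_(D s1 s2 t) F (y s t) = (s1 - s2)^-1 *: 'D_(y s1 t - y s2 t) F (y s t).
  by rewrite /divdiff !deriveE// linearZ.
by rewrite -scalerBr /divdiff !normrZ mulrCA ler_wpM2l.
Qed.

Lemma divdiff_init e : 0 < e -> exists2 d1, 0 < d1 & forall s1 s2, `|s1 - s| < d1 ->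
  `|s2 - s| < d1 -> s1 != s2 -> `|D s1 s2 a - v| <= e.
Proof.
move=> /yv[d1 d10 H]; exists d1 => // s1 s2 h1 h2 sn.
have sn0 : s1 - s2 != 0 by rewrite subr_eq0.
have -> : D s1 s2 a - v = (s1 - s2)^-1 *: (y s1 a - y s2 a - (s1 - s2) *: v).
  by rewrite scalerBr scalerA mulVf// scale1r.
by rewrite normrZ normfV mulrC ler_pdivrMr ?normr_gt0//; exact: H.
Qed.

Lemma divdiff_cauchy e : 0 < e -> exists2 d1, 0 < d1 & forall s1 s2 s3 s4,
  `|s1 - s| < d1 -> `|s2 - s| < d1 -> s1 != s2 ->
  `|s3 - s| < d1 -> `|s4 - s| < d1 -> s3 != s4 -> `|D s1 s2 b - D s3 s4 b| <= e.
Proof.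
move=> e0.
have M0 : 0 < M by rewrite mulr_gt0// ltr_wpDl.
have [d1 /andP[d10 d1d] H1] := traj_lip.
have e8 : 0 < e / 8 by rewrite divr_gt0.
have [d2 d20 H2] := divdiff_init e8.
have [k k0 kK] : exists2 k, 0 < k & K * (2 * (M * k)) * M * (b - a) <= e / 8.
  exists (e / 8 / (M * M + 1)); first by rewrite divr_gt0// ltr_wpDl// mulr_ge0// ltW.
  set M' := M in M0 *.
  have -> : K * (2 * (M' * (e / 8 / (M' * M' + 1)))) * M' * (b - a) =
     (K * (b - a)) * (2 * (e / 8 * (M' * M' / (M' * M' + 1)))) by ring.
  have h : M' * M' / (M' * M' + 1) <= 1.
    by rewrite ler_pdivrMr ?mul1r ?lerDl// ltr_wpDl// mulr_ge0// ltW.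
  have h' : 0 <= M' * M' / (M' * M' + 1).
    by rewrite divr_ge0// ?addr_ge0// mulr_ge0// ltW.
  have h2 : e / 8 * (M' * M' / (M' * M' + 1)) <= e / 8 by rewrite ler_piMr// ltW.
  have h3 : 0 <= e / 8 * (M' * M' / (M' * M' + 1)) by rewrite mulr_ge0// ltW.
  have : K * (b - a) * (2 * (e / 8 * (M' * M' / (M' * M' + 1)))) <=
     2^-1 * (2 * (e / 8 * (M' * M' / (M' * M' + 1)))).
    by rewrite ler_wpM2r// mulr_ge0.
  lra.
pose d3 := Num.min k (Num.min d1 d2).
have d30 : 0 < d3 by rewrite !lt_min k0 d10 d20.
exists d3 => // s1 s2 s3 s4.
rewrite !lt_min => /and3P[k1 g1 f1] /and3P[k2 g2 f2] n12 /and3P[k3 g3 f3] /and3P[k4 g4 f4] n34.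
have hs : `|s - s| < d1 by rewrite subrr normr0.
pose eta := K * (2 * (M * k)) * M + K * (2 * (M * k)) * M.
have err u1 u2 : `|u1 - s| < k -> `|u2 - s| < k -> `|u1 - s| < d1 -> `|u2 - s| < d1 ->
   forall t, a <= t <= b ->
  `|(u1 - u2)^-1 *: (F (y u1 t) - F (y u2 t)) - 'D_(D u1 u2 t) F (y s t)| <=
    K * (2 * (M * k)) * M.
  move=> uk1 uk2 u1d u2d t tab.
  apply: le_trans (divdiff_err (lt_le_trans u1d d1d) (lt_le_trans u2d d1d) tab) _.
  have [q1 _] := H1 _ _ u1d hs t tab; have [q2 _] := H1 _ _ u2d hs t tab.
  have [_ q3] := H1 _ _ u1d u2d t tab.
  have p1 : M * `|u1 - s| <= M * k by rewrite ler_wpM2l// ltW.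
  have p2 : M * `|u2 - s| <= M * k by rewrite ler_wpM2l// ltW.
  by rewrite ler_pM ?mulr_ge0// ?addr_ge0// ler_wpM2l//; lra.
have eta0 : 0 <= eta.
  have v10 : 0 <= `|v| + 1 by rewrite addr_ge0.
  by have k0' := ltW k0; rewrite /eta addr_ge0// !mulr_ge0.
have [bab aab] : a <= b <= b /\ a <= a <= b by rewrite !lexx !ab.
have := @short_time_bound R n (fun t => D s1 s2 t - D s3 s4 t)
  (fun t => (s1 - s2)^-1 *: (F (y s1 t) - F (y s2 t)) -
            (s3 - s4)^-1 *: (F (y s3 t) - F (y s4 t))) a b K eta ab K0 Kab eta0 _ _ b bab.
move=> S; apply: le_trans (S _ _) _ => [t tab|t tab|].
- by apply: is_deriveB; apply: divdiff_is_derive => //; exact: lt_le_trans d1d.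
- have A1 := err _ _ k1 k2 g1 g2 t tab; have A2 := err _ _ k3 k4 g3 g4 t tab.
  have h0 : `|s - s| < d by rewrite subrr normr0.
  have [df dK _] := HF (ysol h0 tab).2.
  have A3 := dK (D s1 s2 t - D s3 s4 t).
  have DE : 'D_(D s1 s2 t - D s3 s4 t) F (y s t) = 'D_(D s1 s2 t) F (y s t) - 'D_(D s3 s4 t) F (y s t).
    by rewrite !deriveE// linearB.
  set w1 := _ *: _ in A1 *; set w2 := _ *: _ in A2 *.
  have -> : w1 - w2 = 'D_(D s1 s2 t - D s3 s4 t) F (y s t) +
     ((w1 - 'D_(D s1 s2 t) F (y s t)) - (w2 - 'D_(D s3 s4 t) F (y s t))).
    rewrite DE; move: ('D_(D s1 s2 t) F (y s t)) ('D_(D s3 s4 t) F (y s t)) => z1 z2.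
    have -> : w1 - z1 - (w2 - z2) = w1 - w2 - (z1 - z2) by rewrite !opprD !opprK addrACA.
    by rewrite [RHS]addrC subrK.
  apply: le_trans (ler_normD _ _) _; apply: lerD => //.
  by apply: le_trans (ler_normB _ _) _; exact: lerD A1 A2.
- have B1 := H2 _ _ f1 f2 n12; have B2 := H2 _ _ f3 f4 n34.
  have B3 : `|D s1 s2 a - D s3 s4 a| <= e / 8 + e / 8.
    have -> : D s1 s2 a - D s3 s4 a = (D s1 s2 a - v) - (D s3 s4 a - v).
      by rewrite opprB addrA subrK.
    by apply: le_trans (ler_normB _ _) _; rewrite lerD.
  by rewrite /eta; lra.
Qed.

Lemma near_dnbhs (P : R -> Prop) (t k : R) : 0 < k ->
  (forall u, `|u - t| < k -> u != t -> P u) -> \forall u \near t^', P u.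
Proof.
move=> k0 H; apply/(@near_ball R R^o); exists k => // u uk; exact: H.
Qed.

Lemma sder_sol : exists2 v', sder (fun s' => y s' b) s v' & D u s b @[u --> s^'] --> v'.
Proof.
have : cvg (D u s b @[u --> s^']).
  apply: cauchy_cvg; apply: cauchy_exP => e e0.
  have e2 : 0 < e / 2 by rewrite divr_gt0.
  have [d1 d10 H] := divdiff_cauchy e2.
  have d2 : 0 < d1 / 2 by rewrite divr_gt0.
  exists (D (s + d1 / 2) s b); apply: (near_dnbhs d10) => u ud un.
  rewrite -ball_normE /=; apply: (@le_lt_trans _ _ (e / 2)); last lra.
  apply: H => //; rewrite ?subrr ?normr0//.
    by rewrite addrAC subrr add0r gtr0_norm//; lra.
  by rewrite -subr_eq0 addrAC subrr add0r gt_eqF.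
move=> /cvg_ex[v' Dv']; exists v' => // e e0.
have e2 : 0 < e / 2 by rewrite divr_gt0.
have [d1 d10 H] := divdiff_cauchy e2.
exists d1 => // s1 s2 h1 h2.
have [->|n12] := eqVneq s1 s2.
  by rewrite !subrr scale0r subr0 normr0 mulr_ge0// ltW.
have sn0 : s1 - s2 != 0 by rewrite subr_eq0.
suff DD : `|D s1 s2 b - v'| <= e.
  have -> : y s1 b - y s2 b - (s1 - s2) *: v' = (s1 - s2) *: (D s1 s2 b - v').
    by rewrite scalerBr /divdiff scalerA mulfV// scale1r.
  by rewrite normrZ mulrC ler_wpM2r.
have /cvgrPdist_le/(_ _ e2) N1 := Dv'.
have N2 : \forall u \near s^', `|D s1 s2 b - D u s b| <= e / 2.
  apply: (near_dnbhs d10) => u ud un; apply: H => //.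
  by rewrite subrr normr0.
have : \forall u \near s^', `|v' - D u s b| <= e / 2 /\ `|D s1 s2 b - D u s b| <= e / 2.
  by apply: filterS2 N1 N2 => u U1 U2; split.
move=> N3; have [u [U1 U2]] := @filter_ex R (s^') (Proper_dnbhs_numFieldType s) _ N3.
rewrite -(subrK (D u s b) (D s1 s2 b)) -addrA.
apply: le_trans (ler_normD _ _) _; rewrite (distrC _ v'); lra.
Qed.

Lemma divdiff_init_cvg : D u s a @[u --> s^'] --> v.
Proof.
apply/cvgrPdist_le => e e0; have [d1 d10 H] := divdiff_init e0.
apply: (near_dnbhs d10) => u ud un; rewrite distrC; apply: H => //.
by rewrite subrr normr0.
Qed.

Variable G : 'rV[R]_n -> 'rV[R]_n -> 'rV[R]_n -> R^o.
Variable C : R.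
Hypothesis C0 : 0 <= C.
Hypothesis Gsym : forall v w x, G v w x = G w v x.
Hypothesis Glin : forall a u v w x, G (a *: u + v) w x = a * G u w x + G v w x.
Hypothesis Gdiff : forall v w x, `|x - x0| < r -> differentiable (G v w) x.
Hypothesis Gbnd : forall v w x, `|x - x0| < r -> `|G v w x| <= K * (`|v| * `|w|).
Hypothesis GC : forall v x, `|x - x0| < r ->
  'D_(F x) (G v v) x + 2 * G ('D_v F x) v x <= 2 * C * G v v x.

Lemma sder_sol_bound : exists2 v', sder (fun s' => y s' b) s v' &
  G v' v' (y s b) <= expR (2 * C * (b - a)) * G v v (y s a).
Proof.
have [v' sv' Dv'] := sder_sol; exists v' => //.
have h0 : `|s - s| < d by rewrite subrr normr0.
have [bab aab] : a <= b <= b /\ a <= a <= b by rewrite !lexx !ab.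
have Gc x : `|x - x0| < r -> forall i j, {for x, continuous (G (delta_mx 0 i) (delta_mx 0 j))}.
  by move=> xr i j; apply: differentiable_continuous; exact: Gdiff.
have L1 := metric_cvg Gsym Glin Dv' (cvg_cst (y s b)) (Gc _ (ysol h0 bab).2).
have L2 := metric_cvg Gsym Glin divdiff_init_cvg (cvg_cst (y s a)) (Gc _ (ysol h0 aab).2).
have M0 : 0 < M by rewrite mulr_gt0// ltr_wpDl.
pose c0 := 2 * (K * (K * M * M * M)).
have c00 : 0 <= c0 by rewrite !mulr_ge0// ?addr_ge0.
have L3 : expR (2 * C * (b - a)) * (G (D u s a) (D u s a) (y s a) + c0 * `|u - s| * (b - a)) @[u --> s^']
   --> expR (2 * C * (b - a)) * (G v v (y s a) + c0 * 0 * (b - a)).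
  apply: (@cvgM R); first exact: cvg_cst.
  apply: (@cvgD R R^o); first exact: L2.
  apply: (@cvgM R); last exact: cvg_cst.
  apply: (@cvgM R); first exact: cvg_cst.
  apply/(@cvgrPdist_le R R^o) => e e0; apply: (near_dnbhs e0) => u ue _.
  by rewrite sub0r normrN normr_id ltW.
rewrite mulr0 mul0r addr0 in L3.
apply: (@ler_cvg_to R (s^') (Proper_dnbhs_numFieldType s) R _ _ _ _ (L1 (dnbhs_filter s) (dnbhs_filter s)) L3).
have [d1 /andP[d10 d1d] H1] := traj_lip.
have hs : `|s - s| < d1 by rewrite subrr normr0.
apply: (near_dnbhs d10) => u ud un.
have ud' := lt_le_trans ud d1d.
pose w t := (u - s)^-1 *: (F (y u t) - F (y s t)).
have C20 : 0 <= 2 * C by rewrite mulr_ge0.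
have ku0 : 0 <= c0 * `|u - s| by rewrite mulr_ge0.
apply: (@gronwall R (fun t => G (D u s t) (D u s t) (y s t))
   (fun t => 2 * G (w t) (D u s t) (y s t) + 'D_(F (y s t)) (G (D u s t) (D u s t)) (y s t))
   a b _ _ ab C20 ku0) => t tab.
  apply: metric_is_derive => //.
  - exact: divdiff_is_derive.
  - exact: (ysol h0 tab).1.
  - by move=> v1 v2; apply: Gdiff; exact: (ysol h0 tab).2.
have yr := (ysol h0 tab).2.
have Q := GC (D u s t) yr.
have err := divdiff_err ud' h0 tab; rewrite subrr normr0 addr0 in err.
rewrite -/(w t) in err.
have [q1 q2] := H1 _ _ ud hs t tab.
have -> : G (w t) (D u s t) (y s t) = G ('D_(D u s t) F (y s t)) (D u s t) (y s t) +
   G (w t - 'D_(D u s t) F (y s t)) (D u s t) (y s t).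
  have := Glin 1 ('D_(D u s t) F (y s t)) (w t - 'D_(D u s t) F (y s t)) (D u s t) (y s t).
  by rewrite scale1r mul1r addrC subrK.
have B := Gbnd (w t - 'D_(D u s t) F (y s t)) (D u s t) yr.
have B1 : `|w t - 'D_(D u s t) F (y s t)| <= K * (M * `|u - s|) * M.
  by apply: le_trans err _; apply: ler_pM; rewrite ?mulr_ge0// ler_wpM2l.
have B2 : `|G (w t - 'D_(D u s t) F (y s t)) (D u s t) (y s t)| <=
   K * (K * (M * `|u - s|) * M * M).
  by apply: le_trans B _; rewrite ler_wpM2l// ler_pM.
have B3 := le_trans (ler_norm _) B2.
have -> : c0 * `|u - s| = 2 * (K * (K * (M * `|u - s|) * M * M)) by rewrite /c0; ring.
lra.
Qed.

End Propagation.

(** * Integral curves in a chart *)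

Section Flow.
Context {R : realType} {n : nat} {M : smoothManifold R n}.
Implicit Types (c : chart R n M) (p : M) (v : 'rV[R]_n).

Lemma compact_ball_rV (x0 : 'rV[R]_n) (rho : R) : compact [set x | `|x - x0| <= rho].
Proof.
have [rho0|rho0] := ltP rho 0.
  have -> : [set x : 'rV[R]_n | `|x - x0| <= rho] = set0.
    by apply/seteqP; split => x //= /(le_trans (normr_ge0 _)); rewrite leNgt rho0.
  exact: compact0.
have -> : [set x : 'rV[R]_n | `|x - x0| <= rho] =
  [set x : 'rV[R]_n | forall i, `[x0 0 i - rho, x0 0 i + rho]%classic (x ord0 i)].
  apply/seteqP; split => x /= H.
    move=> i; rewrite /= in_itv/= -ler_distl.
    by have := le_trans (rv_norm_coord (x - x0) i) H; rewrite !mxE.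
  apply: rv_norm_le => // i; rewrite !mxE ler_distl.
  by have := H i; rewrite in_itv.
by apply: (@rV_compact R n (fun i => `[x0 0 i - rho, x0 0 i + rho]%classic)) => i; exact: segment_compact.
Qed.

Definition global_curve (X : vfield M) (gamma : R -> M) := integral_curve X [set: R] gamma.

Lemma flow_global (X : vfield M) p : complete_vfield X ->
  global_curve X (fun t => flow X t p) /\ flow X 0 p = p.
Proof.
move=> cX; have := cX p; rewrite /global_curve /flow /flow_line.
case: xgetP => [[J f] _ [[_ _ _ f0 fi] _] /= JT|_ /= JT].
  by rewrite JT in fi; split.
have : [set: R] 0 by [].
by rewrite -JT.
Qed.

Lemma curve_cont (X : vfield M) gamma : global_curve X gamma -> forall t, {for t, continuous gamma}.
Proof. by move=> ig t; have [] := ig t I. Qed.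

Lemma curve_is_derive (X : vfield M) gamma c t : global_curve X gamma ->
  atlas c -> chart_dom c (gamma t) ->
  is_derive t (1 : R) (c \o gamma) (local_rep c X (c (gamma t))).
Proof.
move=> ig ac ct; have [cg dg vg] := ig t I.
pose ca := chart_at (gamma t).
have aca : atlas ca by exact: chart_at_atlas.
have cat : chart_dom ca (gamma t) by exact: chart_at_dom.
have dg1 : differentiable (ca \o gamma : R -> 'rV[R]_n) t by apply/derivable1_diffP.
have dt := trans_diff aca ac cat ct.
have E : \forall s \near t, ((c \o chart_inv ca) \o (ca \o gamma)) s = (c \o gamma) s.
  have : \forall s \near t, chart_dom ca (gamma s).
    by apply: cg; apply: open_nbhs_nbhs; split => //; exact: chart_dom_open.
  by apply: filterS => s hs; rewrite /= chart_mapK.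
apply: (near_eq_is_derive E).
have dc : differentiable ((c \o chart_inv ca) \o (ca \o gamma)) t by exact: differentiable_comp.
split; first exact: diff_derivable.
rewrite (derive_comp _ dg1 dt) /local_rep (chart_mapK ct) tangent_coordE /trans -vg /velocity derive1E.
by [].
Qed.

Lemma local_metric_sym g c v w x : local_metric g c v w x = local_metric g c w v x.
Proof. exact: inner_sym. Qed.

Lemma local_metric_lin g c a u v w x : atlas c -> chart_dom c (chart_inv c x) ->
  local_metric g c (a *: u + v) w x = a * local_metric g c u w x + local_metric g c v w x.
Proof. by move=> ac cx; rewrite /local_metric coord_field_lin// inner_linear. Qed.


(* Agrees with [local_metric] over the chart, and is bilinear everywhere. *)
Definition gram (g : riemannian_metric M) c (v w x : 'rV[R]_n) : R^o :=
  \sum_(i < n) \sum_(j < n)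
     (v 0 i * w 0 j) * local_metric g c (delta_mx 0 i) (delta_mx 0 j) x.

Lemma gramE g c v w x : atlas c -> chart_dom c (chart_inv c x) ->
  gram g c v w x = local_metric g c v w x.
Proof.
move=> ac cx; symmetry.
apply: (@metric_expand R n (fun v w _ => local_metric g c v w x) _ _ v w 0).
  by move=> *; exact: local_metric_sym.
by move=> *; exact: local_metric_lin.
Qed.

Lemma gram_sym g c v w x : gram g c v w x = gram g c w v x.
Proof.
rewrite /gram exchange_big /=; apply: eq_bigr => i _; apply: eq_bigr => j _.
by rewrite local_metric_sym mulrC [X in _ * X]mulrC mulrC.
Qed.

Lemma gram_lin g c a u v w x : gram g c (a *: u + v) w x = a * gram g c u w x + gram g c v w x.
Proof.
rewrite /gram big_distrr -big_split /=; apply: eq_bigr => i _.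
rewrite big_distrr -big_split /=; apply: eq_bigr => j _; rewrite !mxE; ring.
Qed.

Lemma gram_near g c v w p : atlas c -> chart_dom c p ->
  \forall x \near c p, local_metric g c v w x = gram g c v w x.
Proof.
move=> ac cp; have := chart_near cp (chart_dom_open c) cp.
by apply: filterS => x [cx _ _]; rewrite gramE.
Qed.

Lemma gram_diff g c v w p : atlas c -> chart_dom c p -> differentiable (gram g c v w) (c p).
Proof.
move=> ac cp; apply: near_eq_differentiable (gram_near g v w ac cp) _.
by apply: (local_metric_smooth g v w ac 1).1; exists p.
Qed.

Lemma gram_bound g c p : atlas c -> chart_dom c p ->
  exists2 K, 0 <= K & \forall x \near c p, forall v w, `|gram g c v w x| <= K * (`|v| * `|w|).
Proof.
move=> ac cp.
pose B i j := `|local_metric g c (delta_mx 0 i) (delta_mx 0 j) (c p)| + 1.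
have B0 i j : 0 <= B i j by rewrite addr_ge0.
exists (\sum_(i < n) \sum_(j < n) B i j).
  by apply: sumr_ge0 => i _; apply: sumr_ge0.
have H : \forall x \near c p, forall i j, `|local_metric g c (delta_mx 0 i) (delta_mx 0 j) x| <= B i j.
  apply: (@near_forall _ _ (nbhs (c p)) _) => i.
  apply: (@near_forall _ _ (nbhs (c p)) _) => j.
  have cc : {for c p, continuous (local_metric g c (delta_mx 0 i) (delta_mx 0 j))}.
    by apply: (Ck_cont (local_metric_smooth g _ _ ac 0)); exists p.
  move/(@cvgrPdist_le R R^o) : cc => /(_ 1 ltr01); apply: filterS => x h.
  have := ler_normD (local_metric g c (delta_mx 0 i) (delta_mx 0 j) x -
    local_metric g c (delta_mx 0 i) (delta_mx 0 j) (c p)) (local_metric g c (delta_mx 0 i) (delta_mx 0 j) (c p)).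
  rewrite subrK distrC => /le_trans; apply; rewrite addrC lerD2l; exact: h.
apply: filterS H => x H v w.
rewrite /gram mulr_suml; apply: le_trans (ler_norm_sum _ _ _) _; apply: ler_sum => i _.
rewrite mulr_suml; apply: le_trans (ler_norm_sum _ _ _) _; apply: ler_sum => j _.
rewrite normrM mulrC; apply: ler_pM => //; rewrite normrM.
by apply: ler_pM => //; exact: rv_norm_coord.
Qed.

Lemma gram_lie (g : riemannian_metric M) (nabla : affine_connection M) (X : vfield M) c p v C :
  levi_civita g nabla -> smooth_vfield [set: M] X ->
  (forall q (w : tangent q), g q (nabla q w X) w <= C * g q w w) ->
  atlas c -> chart_dom c p ->
  'D_(local_rep c X (c p)) (gram g c v v) (c p) +
   2 * gram g c ('D_v (local_rep c X) (c p)) v (c p) <= 2 * C * gram g c v v (c p).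
Proof.
move=> lc sX HC ac cp.
have cp' : chart_dom c (chart_inv c (c p)) by rewrite chart_mapK.
rewrite !gramE// -(near_eq_derive _ (gram_near g v v ac cp)).
by rewrite (lie_identity v lc sX ac cp) {1}/local_metric chart_mapK// -mulrA ler_wpM2l.
Qed.

Definition local_bounds (X : vfield M) (g : riemannian_metric M) c (x0 : 'rV[R]_n) (r K : R) :=
  [/\ 0 < r /\ 0 <= K,
    (forall z, `|z - x0| < r -> exists2 q, chart_dom c q & c q = z),
    (forall z, `|z - x0| < r ->
      [/\ differentiable (local_rep c X) z,
         (forall v, `|'D_v (local_rep c X) z| <= K * `|v|),
         (forall y, `|y - x0| < r -> `|local_rep c X y - local_rep c X z| <= K * `|y - z|) &
         `|local_rep c X z| <= K]),
    (forall x y z, `|x - x0| < r -> `|y - x0| < r -> `|z - x0| < r ->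
       `|local_rep c X x - local_rep c X y - 'D_(x - y) (local_rep c X) z| <=
         K * (`|x - z| + `|y - z|) * `|x - y|) &
    (forall v w x, `|x - x0| < r -> differentiable (gram g c v w) x /\
       `|gram g c v w x| <= K * (`|v| * `|w|))].


Lemma local_boundsP (X : vfield M) g c p : smooth_vfield [set: M] X -> atlas c -> chart_dom c p ->
  exists r K, local_bounds X g c (c p) r K.
Proof.
move=> sX ac cp.
have sF := local_rep_smooth ac sX.
have oI := @chart_img_open _ _ _ c.
have Ip : (c @` chart_dom c) (c p) by exists p.
have [K1 K10 H1] := C1_lip oI (sF 1) Ip.
have [K2 K20 H2] := C2_lip oI (sF 2) Ip.
have [K3 K30 /near_ball[r3 r30 H3]] := gram_bound g ac cp.
have : \forall r \near 0^'+, local_bounds X g c (c p) r (K1 + K2 + K3).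
  near=> r.
  have r0 : 0 < r by [].
  have H1r : forall z, `|z - c p| < r -> [/\ (c @` chart_dom c) z, `|local_rep c X z| <= K1,
      (forall v, `|'D_v (local_rep c X) z| <= K1 * `|v|) &
     forall y, `|y - c p| < r -> `|local_rep c X y - local_rep c X z| <= K1 * `|y - z|].
    by near: r.
  have H2r : forall x y z, `|x - c p| < r -> `|y - c p| < r -> `|z - c p| < r ->
     `|local_rep c X x - local_rep c X y - 'D_(x - y) (local_rep c X) z| <=
     K2 * (`|x - z| + `|y - z|) * `|x - y|.
    by near: r.
  have rr3 : r <= r3 by near: r; exact: nbhs_right_le.
  have Kl1 : K1 <= K1 + K2 + K3 by lra.
  have Kl2 : K2 <= K1 + K2 + K3 by lra.
  have Kl3 : K3 <= K1 + K2 + K3 by lra.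
  split.
  - by split => //; rewrite !addr_ge0.
  - by move=> z /H1r[[q cq qz] _ _ _]; exists q.
  - move=> z zr; have [Iz h1 h2 h3] := H1r z zr; split.
    + exact: (sF 1).1.
    + by move=> v; apply: le_trans (h2 v) _; rewrite ler_wpM2r.
    + by move=> y yr; apply: le_trans (h3 y yr) _; rewrite ler_wpM2r.
    + exact: le_trans h1 Kl1.
  - move=> x y z xr yr zr; apply: le_trans (H2r x y z xr yr zr) _.
    by rewrite ler_wpM2r// ler_wpM2r// addr_ge0.
  - move=> v w x xr; have [[q cq qx] _ _ _] := H1r x xr; split.
      by rewrite -qx; exact: gram_diff.
    apply: le_trans (H3 x (lt_le_trans xr rr3) v w) _.
    by rewrite ler_wpM2r// mulr_ge0.
move=> H; have [r Hr] := @filter_ex R (0^'+) (at_right_proper_filter 0) _ H.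
by exists r, (K1 + K2 + K3).
Unshelve. all: by end_near. Qed.

(* The trajectory cannot leave the chart at its first exit time: before that it
   stays over a smaller closed ball, whose image in M is compact, hence closed. *)
Lemma trapping (X : vfield M) g c x0 r K gamma a b : local_bounds X g c x0 r K ->
  atlas c -> global_curve X gamma ->
  chart_dom c (gamma a) -> `|c (gamma a) - x0| < r / 2 -> K * (b - a) < r / 2 ->
  forall t, a <= t <= b -> chart_dom c (gamma t) /\ `|c (gamma t) - x0| < r.
Proof.
move=> [[r0 K0] HI HF _ _] ac ig ca car Kab.
apply: real_induction.
- by split => //; lra.
- move=> t tab H; have [ct tr] : chart_dom c (gamma t) /\ `|c (gamma t) - x0| < r.
    by apply: H; lra.
  have gt : {for t, continuous gamma} by exact: curve_cont ig t.
  have N1 : \forall s \near t, chart_dom c (gamma s).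
    by apply: gt; apply: open_nbhs_nbhs; split => //; exact: chart_dom_open.
  have cgt : {for t, continuous (c \o gamma)}.
    by apply: continuous_comp => //; exact: chart_map_continuous.
  have B : \forall z \near c (gamma t), `|z - x0| < r.
    apply/near_ball; exists (r - `|c (gamma t) - x0|); first by rewrite subr_gt0.
    move=> z zr; rewrite -(subrK (c (gamma t)) z) -addrA.
    by apply: le_lt_trans (ler_normD _ _) _; rewrite -ltrBrDr.
  have N2 : \forall s \near t, `|c (gamma s) - x0| < r by exact: (cgt _ B).
  have : \forall s \near t, chart_dom c (gamma s) /\ `|c (gamma s) - x0| < r by apply: filterI.
  move=> /(@near_ball R R^o)[d d0 Hd].
  exists d => // u /andP[tu ud]; apply: Hd; rewrite gtr0_norm; lra.
- move=> t tab H.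
  pose rho := `|c (gamma a) - x0| + K * (b - a).
  have rr : rho < r by rewrite /rho; lra.
  have Hrho u : a <= u < t -> `|c (gamma u) - x0| <= rho.
    move=> uat; have au : a <= u by case/andP: uat.
    have dc s : a <= s <= u -> is_derive s (1 : R) (c \o gamma) (local_rep c X (c (gamma s))).
      by move=> sau; apply: curve_is_derive => //; apply: (H s _).1; lra.
    have bc s : a <= s <= u -> `|local_rep c X (c (gamma s))| <= K.
      by move=> sau; have [|_ sr] := H s; [lra|have [] := HF _ sr].
    have h := mvt_norm au dc bc.
    rewrite -(subrK (c (gamma a)) (c (gamma u))) -addrA /rho addrC.
    apply: le_trans (ler_normD _ _) _; rewrite addrC lerD// (le_trans h)// ler_wpM2l//; lra.
  have Bsub x : `|x - x0| <= rho -> exists2 q, chart_dom c q & c q = x.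
    by move=> xr; apply: HI; exact: le_lt_trans rr.
  have cK : compact (chart_inv c @` [set x | `|x - x0| <= rho]).
    apply: continuous_compact; last exact: compact_ball_rV.
    apply: continuous_in_subspaceT => x; rewrite inE /= => /Bsub[q cq qx].
    by apply: chart_inv_continuous; exists q.
  have clK := compact_closed (@manifold_hausdorff _ _ M) cK.
  have Kt : (chart_inv c @` [set x | `|x - x0| <= rho]) (gamma t).
    apply: (@closed_cvg R M (t^'-) (at_left_proper_filter t) gamma _ clK).
      near=> u.
      have ut : a <= u < t.
        apply/andP; split; last by near: u; exact: nbhs_left_lt.
        by near: u; apply: nbhs_left_ge; lra.
      exists (c (gamma u)); first exact: Hrho.
      by rewrite chart_mapK//; exact: (H u ut).1.
    by apply: cvg_at_left_filter; apply: (curve_cont ig).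
  have [x xr xE] := Kt; have [q cq qx] := Bsub x xr.
  by rewrite -xE -qx chart_mapK//; split => //; rewrite qx; exact: le_lt_trans rr.
Unshelve. all: by end_near. Qed.

End Flow.

(** * Regularity of the flow *)

Section FlowRegularity.
Context {R : realType} {n : nat} {M : smoothManifold R n}.
Variables (X : vfield M) (g : riemannian_metric M).
Hypothesis sX : smooth_vfield [set: M] X.
Hypothesis cX : complete_vfield X.
Implicit Types (c : chart R n M) (p : M).

Definition flow_window c r K d ts p :=
  [/\ atlas c, local_bounds X g c (c (flow X ts p)) r K, 0 < d,
   (forall u, `|u - ts| < d -> chart_dom c (flow X u p) /\
       `|c (flow X u p) - c (flow X ts p)| < r / 2) &
   (forall u v, u <= v -> `|u - ts| < d -> `|v - ts| < d ->
      K * (v - u) <= 2^-1 /\ K * (v - u) < r / 2)].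

Lemma flow_curve p : global_curve X (fun t => flow X t p).
Proof. exact: (flow_global p cX).1. Qed.

Lemma near_half_ball (V : normedModType R) (z x0 : V) r : `|z - x0| < r ->
  \forall y \near z, `|y - x0| < r.
Proof.
move=> zr; apply/near_ball; exists (r - `|z - x0|); first by rewrite subr_gt0.
move=> y yr; rewrite -(subrK z y) -addrA.
by apply: le_lt_trans (ler_normD _ _) _; rewrite -ltrBrDr.
Qed.

Lemma flow_windowP ts p : exists c r K d, flow_window c r K d ts p.
Proof.
pose c := chart_at (flow X ts p).
have ac : atlas c by exact: chart_at_atlas.
have cp : chart_dom c (flow X ts p) by exact: chart_at_dom.
have [r [K lb]] := local_boundsP g sX ac cp.
have [[r0 K0] _ _ _ _] := lb.
have r2 : 0 < r / 2 by rewrite divr_gt0.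
have ct : {for ts, continuous (fun t => flow X t p)}.
  by apply: (@curve_cont _ _ _ X); exact: flow_curve.
have N1 : \forall s \near ts, chart_dom c (flow X s p).
  by apply: ct; apply: open_nbhs_nbhs; split => //; exact: chart_dom_open.
have cgt : {for ts, continuous (c \o (fun t => flow X t p))}.
  by apply: continuous_comp => //; exact: chart_map_continuous.
have B : \forall z \near c (flow X ts p), `|z - c (flow X ts p)| < r / 2.
  by apply: near_half_ball; rewrite subrr normr0.
have N2 : \forall s \near ts, `|c (flow X s p) - c (flow X ts p)| < r / 2 by exact: (cgt _ B).
have : \forall s \near ts, chart_dom c (flow X s p) /\
   `|c (flow X s p) - c (flow X ts p)| < r / 2 by apply: filterI.
move=> /(@near_ball R R^o)[d1 d10 Hd].
have m0 : 0 < Num.min 1 r by rewrite lt_min ltr01 r0.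
have K1 : 0 < K + 1 by rewrite ltr_wpDl.
pose d2 := Num.min 1 r / (8 * (K + 1)).
have d20 : 0 < d2 by rewrite divr_gt0// mulr_gt0.
have d2K : d2 * (8 * (K + 1)) = Num.min 1 r by rewrite mulfVK// gt_eqF// mulr_gt0.
have [m1 mr] : Num.min 1 r <= 1 /\ Num.min 1 r <= r by rewrite !ge_min !lexx orbT.
have Kd2 : 0 <= K * d2 by rewrite mulr_ge0// ltW.
exists c, r, K, (Num.min d1 d2); split => //.
- by rewrite lt_min d10.
- by move=> u; rewrite lt_min => /andP[ud _]; exact: Hd.
- move=> u v uv; rewrite !lt_min => /andP[_ ud] /andP[_ vd].
  have vu : v - u <= 2 * d2 by move: ud vd; rewrite !ltr_norml; lra.
  have : K * (v - u) <= K * (2 * d2) by rewrite ler_wpM2l.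
  by split; lra.
Qed.

Lemma near_window c r K d ts p (T : topologicalType) (sg : T -> M) (s : T) u :
  flow_window c r K d ts p -> sg s = p ->
  {for s, continuous (fun s' => flow X u (sg s'))} -> `|u - ts| < d ->
  \forall s' \near s, chart_dom c (flow X u (sg s')) /\
    `|c (flow X u (sg s')) - c (flow X ts p)| < r / 2.
Proof.
move=> [ac lb d0 Hd _] sp cu ud; have [cp rp] := Hd u ud.
rewrite -sp in cp rp.
have N1 : \forall s' \near s, chart_dom c (flow X u (sg s')).
  by apply: cu; apply: open_nbhs_nbhs; split => //; exact: chart_dom_open.
have cgt : {for s, continuous (c \o (fun s' => flow X u (sg s')))}.
  by apply: continuous_comp => //; exact: chart_map_continuous.
have B := near_half_ball rp.
have N2 : \forall s' \near s, `|c (flow X u (sg s')) - c (flow X ts (sg s))| < r / 2.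
  exact: (cgt _ B).
by rewrite sp in N2; apply: filterI.
Qed.

Lemma window_sol c r K d ts p q u v : flow_window c r K d ts p ->
  `|u - ts| < d -> `|v - ts| < d -> u <= v ->
  chart_dom c (flow X u q) -> `|c (flow X u q) - c (flow X ts p)| < r / 2 ->
  (forall t, u <= t <= v -> chart_dom c (flow X t q)) /\
  sol (local_rep c X) (c (flow X ts p)) r u v (fun t => c (flow X t q)).
Proof.
move=> [ac lb d0 Hd HK] ud vd uv cq rq.
have [_ Kr] := HK u v uv ud vd.
have T := trapping lb ac (flow_curve q) cq rq Kr.
split=> t tab; have [ct rt] := T t tab; first exact: ct.
split; [exact: (curve_is_derive (flow_curve q) ac ct)|exact: rt].
Qed.

Lemma window_HF c r K d ts p : flow_window c r K d ts p ->
 forall z, `|z - c (flow X ts p)| < r ->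
  [/\ differentiable (local_rep c X) z, (forall v, `|'D_v (local_rep c X) z| <= K * `|v|) &
      forall y, `|y - c (flow X ts p)| < r -> `|local_rep c X y - local_rep c X z| <= K * `|y - z|].
Proof. by move=> [_ [_ _ H _ _] _ _ _] z /H[]. Qed.

Lemma flow_continuous t p : 0 <= t -> {for p, continuous (flow X t)}.
Proof.
move=> t0; pose P t := {for p, continuous (flow X t)}.
apply: (@forward_induction R P) t t0.
  have E q : flow X 0 q = q by exact: (flow_global q cX).2.
  by rewrite /P (_ : flow X 0 = id)//; apply/funext.
move=> ts ts0; have [c [r [K [d W]]]] := flow_windowP ts p.
have [ac lb d0 Hd HK] := W; have [[r0 K0] HI _ HF2 _] := lb.
exists d => // u v u0 uv ud vd Pu.
have N := near_window (sg := id) W (erefl _) Pu ud.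
have [cu ru] := Hd u ud; have [cv rv] := Hd v vd.
have [Kuv _] := HK u v uv ud vd.
have [_ Sp] := window_sol W ud vd uv cu ru.
have vuv : u <= v <= v by rewrite uv lexx.
have L : \forall q \near p, chart_dom c (flow X v q) /\
   `|c (flow X v q) - c (flow X v p)| <= 2 * `|c (flow X u q) - c (flow X u p)|.
  apply: filterS N => q [cq rq]; have [Dq Sq] := window_sol W ud vd uv cq rq.
  split; first exact: Dq.
  exact: (sol_lip K0 uv Kuv (window_HF W) Sq Sp vuv).
have cuc : c (flow X u q) @[q --> p] --> c (flow X u p).
  have h : {for p, continuous (c \o flow X u)}.
    by apply: continuous_comp => //; exact: chart_map_continuous.
  exact: h.
have cvc : c (flow X v q) @[q --> p] --> c (flow X v p).
  apply/cvgrPdist_le => e e0; have e2 : 0 < e / 2 by rewrite divr_gt0.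
  move/cvgrPdist_le : cuc => /(_ _ e2) cuc.
  apply: filterS2 L cuc => q [_ h1] h2; rewrite distrC; apply: le_trans h1 _.
  by rewrite distrC in h2; lra.
have ci : {for c (flow X v p), continuous (chart_inv c)}.
  by apply: chart_inv_continuous; exists (flow X v p).
rewrite /P /prop_for /continuous_at -[in X in _ --> X](chart_mapK cv).
have := cvg_comp _ _ cvc ci; apply: cvg_trans; apply: near_eq_cvg.
by apply: filterS L => q [cq _] /=; rewrite chart_mapK.
Qed.

Variables (nabla : affine_connection M) (C : R).
Hypothesis lc : levi_civita g nabla.
Hypothesis C0 : 0 <= C.
Hypothesis HC : forall q (w : tangent q), g q (nabla q w X) w <= C * g q w w.

Definition strict_velocity (sg : R -> M) (s : R) (w : tangent (sg s)) :=
  forall c, atlas c -> chart_dom c (sg s) -> sder (c \o sg) s (tangent_coord c w).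

Lemma sder_chart (sg : R -> M) (s : R) c c' v : {for s, continuous sg} ->
  atlas c -> atlas c' -> chart_dom c (sg s) -> chart_dom c' (sg s) ->
  sder (c \o sg) s v -> sder (c' \o sg) s (trans c c' (sg s) v).
Proof.
move=> cs ac ac' cp cp' sd.
have oI : open (c @` (chart_dom c' `&` chart_dom c)).
  by apply: chart_img_openI; exact: chart_dom_open.
have Ip : (c @` (chart_dom c' `&` chart_dom c)) ((c \o sg) s) by exists (sg s).
have h := sder_comp oI (trans_smooth ac ac' 1) Ip sd.
apply: sder_near h.
have : \forall s' \near s, chart_dom c (sg s').
  by apply: cs; apply: open_nbhs_nbhs; split => //; exact: chart_dom_open.
by apply: filterS => s' hs; rewrite /= chart_mapK.
Qed.

Lemma strict_velocity_chart (sg : R -> M) (s : R) c v : {for s, continuous sg} ->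
  atlas c -> chart_dom c (sg s) -> sder (c \o sg) s v ->
  strict_velocity (coord_field c v (sg s)).
Proof.
move=> cs ac cp sd c' ac' cp'.
have := sder_chart cs ac ac' cp cp' sd.
by rewrite -(tangent_coord_trans _ ac ac' cp cp') coord_fieldK.
Qed.

Lemma flow_strict (sg : R -> M) (s : R) (w : tangent (sg s)) : {for s, continuous sg} ->
  strict_velocity w -> forall t, 0 <= t ->
  exists w' : tangent (flow X t (sg s)),
    @strict_velocity (fun s' => flow X t (sg s')) s w' /\
    g _ w' w' <= expR (2 * C * t) * g _ w w.
Proof.
move=> cs sw; have cst t : 0 <= t -> {for s, continuous (fun s' => flow X t (sg s'))}.
  by move=> t0; apply: continuous_comp => //; exact: flow_continuous.
apply: forward_induction.
  have E q : flow X 0 q = q by exact: (flow_global q cX).2.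
  have -> : flow X 0 = id by apply/funext.
  by exists w; rewrite mulr0 expR0 mul1r.
move=> ts ts0; have [c [r [K [d W]]]] := flow_windowP ts (sg s).
have [ac lb d0 Hd HK] := W; have [[r0 K0] HI _ HF2 HG] := lb.
exists d => // u v u0 uv ud vd [wu [swu gwu]].
have v0 := le_trans u0 uv.
have [cu ru] := Hd u ud; have [cv rv] := Hd v vd.
have [Kuv _] := HK u v uv ud vd.
have N := near_window (sg := sg) W (erefl _) (cst u u0) ud.
move/(@near_ball R R^o) : N => [d1 d10 Hd1].
have ys s' : `|s' - s| < d1 -> sol (local_rep c X) (c (flow X ts (sg s))) r u v (fun t => c (flow X t (sg s'))).
  by move=> /Hd1[cq rq]; exact: (window_sol W ud vd uv cq rq).2.
have Gd v1 w1 x : `|x - c (flow X ts (sg s))| < r -> differentiable (gram g c v1 w1) x.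
  by move=> /(HG v1 w1)[].
have Gb v1 w1 x : `|x - c (flow X ts (sg s))| < r -> `|gram g c v1 w1 x| <= K * (`|v1| * `|w1|).
  by move=> /(HG v1 w1)[].
have GCx v1 x : `|x - c (flow X ts (sg s))| < r ->
  'D_(local_rep c X x) (gram g c v1 v1) x + 2 * gram g c ('D_v1 (local_rep c X) x) v1 x <= 2 * C * gram g c v1 v1 x.
  by move=> /HI[q cq <-]; exact: (gram_lie v1 lc sX HC ac cq).
have [v' sv' gv'] := sder_sol_bound K0 uv Kuv (window_HF W) HF2
   (y := fun s' t => c (flow X t (sg s'))) d10 ys (swu c ac cu) C0
   (@gram_sym _ _ _ g c) (@gram_lin _ _ _ g c) Gd Gb GCx.
exists (coord_field c v' (flow X v (sg s))); split.
  exact: (@strict_velocity_chart (fun s' => flow X v (sg s')) s c v' (cst v v0) ac cv sv').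
have cv' : chart_dom c (chart_inv c (c (flow X v (sg s)))) by rewrite chart_mapK.
have cu' : chart_dom c (chart_inv c (c (flow X u (sg s)))) by rewrite chart_mapK.
move: gv'; rewrite !gramE// /local_metric !chart_mapK// tangent_coordK// => h.
apply: le_trans h _; apply: le_trans (ler_wpM2l (expR_ge0 _) gwu) _.
by rewrite mulrA -expRD -mulrDr subrK.
Qed.

End FlowRegularity.

(** * Speed and length of curves *)

Section Curves.
Context {R : realType} {n : nat} {M : smoothManifold R n}.
Implicit Types (c : chart R n M) (p : M).

Definition speed (g : riemannian_metric M) (sg : R -> M) (s : R) : R :=
  tangent_norm g (velocity sg s).

Lemma preimage_near (sg : R -> M) (J : set R) c s : open J ->
  (forall t, J t -> {for t, continuous sg}) -> J s -> chart_dom c (sg s) ->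
  \forall t \near s, J t /\ chart_dom c (sg t).
Proof.
move=> oJ cs Js cp.
have N1 : \forall t \near s, J t by apply: open_nbhs_nbhs.
have N2 : \forall t \near s, chart_dom c (sg t).
  by apply: (cs s Js); apply: open_nbhs_nbhs; split => //; exact: chart_dom_open.
exact: filterI.
Qed.

Lemma preimage_open (sg : R -> M) (J : set R) c : open J ->
  (forall t, J t -> {for t, continuous sg}) ->
  open (J `&` sg @^-1` chart_dom c : set R^o).
Proof.
move=> oJ cs; rewrite openE => s [Js cp]; exact: preimage_near.
Qed.

Lemma strict_velocityE (sg : R -> M) s (w : tangent (sg s)) : strict_velocity w ->
  velocity sg s = w.
Proof.
move=> H; have ap := chart_at_atlas (sg s); have dp := chart_at_dom (sg s).
have [_ h] := sder_diff (H _ ap dp).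
rewrite /velocity derive1E -[RHS](tangent_coordK w ap dp) [RHS]/coord_field trans_id//.
Qed.

Lemma C1_strict_velocity (J : set R) (sg : R -> M) : open J -> C1_curve J sg ->
  forall s, J s -> strict_velocity (velocity sg s).
Proof.
move=> oJ [cs Hs] s Js; have ap := chart_at_atlas (sg s); have dp := chart_at_dom (sg s).
have h := @C1_sder R n _ _ (preimage_open (c := chart_at (sg s)) oJ cs) (Hs _ ap) s (conj Js dp).
have E : coord_field (chart_at (sg s)) ('D_(1 : R) (chart_at (sg s) \o sg) s) (sg s) = velocity sg s.
  by apply: etrans (trans_id _ dp) _; rewrite /velocity derive1E.
rewrite -E; exact: strict_velocity_chart (cs s Js) ap dp h.
Qed.

Lemma strict_C1_curve (J : set R) (sg : R -> M) : open J ->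
  (forall s, J s -> {for s, continuous sg}) ->
  (forall s, J s -> exists w : tangent (sg s), strict_velocity w) -> C1_curve J sg.
Proof.
move=> oJ cs H; split => // c ac.
apply: (@sder_C1 R n (c \o sg) (fun s => 'D_(1 : R) (c \o sg) s)) => [|s [Js cp]].
  exact: preimage_open.
have [w Hw] := H s Js; have sd := Hw c ac cp.
by have [_ E] := sder_diff sd; rewrite E.
Qed.

Lemma C1_curve_ext (J : set R) (sg gamma : R -> M) : open J ->
  (forall s, J s -> sg s = gamma s) -> C1_curve J sg -> C1_curve J gamma.
Proof.
move=> oJ E [cs Hs]; split.
  move=> s Js; rewrite /prop_for /continuous_at -(E _ Js).
  apply: cvg_trans (cs s Js); apply: near_eq_cvg.
  have : \forall t \near s, J t by apply: open_nbhs_nbhs.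
  by apply: filterS => t /E.
move=> c ac.
have -> : J `&` gamma @^-1` chart_dom c = J `&` sg @^-1` chart_dom c.
  by apply/seteqP; split => s [Js] /=; rewrite E.
apply: Ck_ext (Hs c ac); first exact: preimage_open.
by move=> s [Js _] /=; rewrite E.
Qed.

Lemma C1_curve_sub (J J' : set R) (sg : R -> M) : J' `<=` J ->
  C1_curve J sg -> C1_curve J' sg.
Proof.
move=> JJ [cs Hs]; split => [s /JJ/cs//|c ac].
by apply: Ck_sub (Hs c ac) => s [/JJ].
Qed.

Lemma speed_continuous g (J : set R) (sg : R -> M) : open J -> C1_curve J sg ->
  forall s, J s -> {for s, continuous (speed g sg)}.
Proof.
move=> oJ HC s Js; have [cs Hs] := HC.
pose c := chart_at (sg s).
have ap : atlas c := chart_at_atlas (sg s); have dp : chart_dom c (sg s) := chart_at_dom (sg s).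
have N := preimage_near oJ cs Js dp.
pose v t := 'D_(1 : R) (c \o sg) t.
have E : \forall t \near s, Num.sqrt (gram g c (v t) (v t) (c (sg t))) = speed g sg t.
  apply: filterS N => t [Jt ct].
  have ct' : chart_dom c (chart_inv c (c (sg t))) by rewrite chart_mapK.
  have [_ vE] := sder_diff (C1_strict_velocity oJ HC Jt ap ct).
  rewrite /v vE (gramE _ _ _ ap ct') /local_metric (chart_mapK ct).
  by rewrite (tangent_coordK _ ap ct).
have vc : v t @[t --> s] --> v s.
  by have [_ D] := Hs c ap; apply: (D (1 : R) s).
have cc : c (sg t) @[t --> s] --> c (sg s).
  have : {for s, continuous (c \o sg)}.
    by apply: continuous_comp; [exact: cs|exact: chart_map_continuous].
  exact.
have Gc i j : {for c (sg s), continuous (gram g c (delta_mx 0 i) (delta_mx 0 j))}.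
  by apply: differentiable_continuous; exact: gram_diff.
have L : gram g c (v t) (v t) (c (sg t)) @[t --> s] --> gram g c (v s) (v s) (c (sg s)).
  exact: (@metric_cvg R n (gram g c) (@gram_sym _ _ _ g c) (@gram_lin _ _ _ g c) R (nbhs s) _
    v (c \o sg) (v s) (c (sg s)) vc cc Gc).
have L' : Num.sqrt (gram g c (v t) (v t) (c (sg t))) @[t --> s] --> Num.sqrt (gram g c (v s) (v s) (c (sg s))).
  by apply: (cvg_comp _ _ L); exact: sqrt_continuous.
rewrite /prop_for /continuous_at -(nbhs_singleton E).
by apply: cvg_trans L'; exact: near_eq_cvg.
Qed.

Lemma measurable_fun_finite (D : set R) (f : R -> R) : finite_set D -> measurable_fun D f.
Proof.
move=> fD mD Y mY; apply: countable_measurable; first by move=> t; exact: measurable_set1.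
by apply: finite_set_countable; apply: sub_finite_set fD => t [].
Qed.

Lemma measurable_fun_off_finite (a b : R) (S : set R) (f : R -> R) : finite_set S ->
  S a -> S b -> (forall t, a <= t <= b -> ~ S t -> {for t, continuous f}) ->
  measurable_fun `[a, b] f.
Proof.
move=> fS Sa Sb H.
have oO : open (`]a, b[ `&` ~` S).
  apply: openI; first exact: itv_open.
  rewrite openC; apply: (accessible_finite_set_closed.1 (hausdorff_accessible (@Rhausdorff R))) => //.
have -> : `[a, b]%classic = (`]a, b[ `&` ~` S) `|` (`[a, b] `&` S).
  apply/seteqP; split => t /=; rewrite !in_itv /=.
    move=> tab; have [St|nSt] := pselect (S t); first by right.
    left; split => //; move/andP: tab => [ta tb]; rewrite !lt_neqAle ta tb !andbT.
    apply/andP; split; apply/eqP => e; apply: nSt; first by rewrite -e.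
    by rewrite e.
  by move=> [[/andP[ta tb] _]|[]//]; rewrite !ltW.
have fI : finite_set (`[a, b] `&` S) by apply: sub_finite_set fS => t [].
apply/measurable_funU.
- exact: open_measurable.
- apply: countable_measurable; first by move=> t; exact: measurable_set1.
  exact: finite_set_countable.
split; last exact: measurable_fun_finite.
apply: open_continuous_measurable_fun => // t.
rewrite inE /= in_itv/= => -[/andP[ta tb] nS]; apply: H => //.
by rewrite !ltW.
Qed.

Lemma integral_le_off_finite (a b k : R) (S : set R) (f h : R -> R) : finite_set S ->
  S a -> S b -> 0 <= k -> (forall t, 0 <= f t) -> (forall t, 0 <= h t) ->
  (forall t, a <= t <= b -> ~ S t ->
    [/\ {for t, continuous f}, {for t, continuous h} & f t <= k * h t]) ->
  (\int[lebesgue_measure]_(t in `[a, b]) (f t)%:E <=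
   (\int[lebesgue_measure]_(t in `[a, b]) (h t)%:E) * k%:E)%E.
Proof.
move=> fS Sa Sb k0 f0 h0 H.
have mf : measurable_fun `[a, b] (EFin \o f).
  apply/measurable_EFinP; apply: (measurable_fun_off_finite fS) => // t tab nS.
  by have [] := H t tab nS.
have mh : measurable_fun `[a, b] (EFin \o h).
  apply/measurable_EFinP; apply: (measurable_fun_off_finite fS) => // t tab nS.
  by have [] := H t tab nS.
rewrite muleC -ge0_integralZl_EFin//; last by move=> t _; rewrite lee_fin.
apply: ae_ge0_le_integral => //.
- by move=> t _; rewrite lee_fin.
- by move=> t _; rewrite mule_ge0// lee_fin.
- exact: measurable_funeM.
- exists S; split.
  + apply: countable_measurable; first by move=> t; exact: measurable_set1.
    exact: finite_set_countable.
  + by apply: countable_lebesgue_measure0; exact: finite_set_countable.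
  + move=> t /=; rewrite in_itv/=; apply: contra_notP => nS tab.
    by rewrite -EFinM lee_fin; have [] := H t tab nS.
Qed.

Lemma piecewise_point (N : nat) (tau : nat -> R) t :
  tau 0%N <= t <= tau N -> (forall i, (i <= N)%N -> tau i <> t) ->
  exists2 i, (i < N)%N & tau i < t < tau i.+1.
Proof.
elim: N => [|N IH] tN nt.
  by have := nt 0%N isT; rewrite -eq_le in tN; move/eqP: tN.
have [tl|tl] := leP t (tau N).
  have [|i iN|i iN it] := IH; first by rewrite tl; case/andP: tN => ->.
    by apply: nt; exact: leqW.
  by exists i => //; exact: ltnW.
exists N => //; rewrite tl/= lt_neqAle; case/andP: tN => _ ->; rewrite andbT.
by apply/eqP => e; apply: (nt N.+1) => //; rewrite e.
Qed.

End Curves.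

(** * The distance estimate *)

Section Metric.
Context {R : realType} {n : nat} {M : smoothManifold R n}.
Variable g : riemannian_metric M.

Lemma inner0 p (w : tangent p) : g p 0 w = 0.
Proof.
have := inner_linear g 1 (0 : tangent p) 0 w.
by rewrite scaler0 addr0 mul1r => h; apply: (@addrI _ (g p 0 w)); rewrite addr0 -h.
Qed.

Lemma inner_ge0 p (w : tangent p) : 0 <= g p w w.
Proof.
by have [->|w0] := eqVneq w 0; [rewrite inner0|rewrite ltW// inner_gt0].
Qed.

Lemma inner_linr p (a : R) (u v w : tangent p) : g p w (a *: u + v) = a * g p w u + g p w v.
Proof. by rewrite inner_sym inner_linear !(inner_sym g w). Qed.

Lemma inner_scale p (a : R) (u : tangent p) : g p (a *: u) (a *: u) = a ^+ 2 * g p u u.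
Proof.
rewrite -[a *: u]addr0 inner_linear inner_linr inner0 (inner_sym g u) inner0; ring.
Qed.

Lemma inner_CS p (u v : tangent p) : (g p u v) ^+ 2 <= g p u u * g p v v.
Proof.
have [->|u0] := eqVneq u 0; first by rewrite !inner0 expr0n /= mul0r.
have uu := inner_gt0 g u0.
pose a := - (g p u v / g p u u).
have := inner_ge0 (a *: u + v).
rewrite inner_linear !inner_linr (inner_sym g v u).
have -> : a * (a * g p u u + g p u v) + (a * g p u v + g p v v) =
    (g p u u * g p v v - g p u v ^+ 2) / g p u u.
  by rewrite /a; field; rewrite gt_eqF.
by rewrite pmulr_lge0 ?invr_gt0// subr_ge0.
Qed.

Lemma tangent_norm_ge0 p (w : tangent p) : 0 <= tangent_norm g w.
Proof. exact: sqrtr_ge0. Qed.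

End Metric.

Section NormBound.
Context {R : realType} {n : nat} {M : smoothManifold R n}.
Variables (g : riemannian_metric M) (nabla : affine_connection M) (X : vfield M).
Hypothesis sX : smooth_vfield [set: M] X.

Lemma covZ p (a : R) (u : tangent p) : nabla p (a *: u) X = a *: nabla p u X.
Proof.
have H b v w := @cov_linear _ _ _ nabla [set: M] X p b v w openT I sX.
have c0 : nabla p 0 X = 0.
  have := H 1 0 0; rewrite scaler0 addr0 scale1r => h.
  by apply: (@addrI _ (nabla p 0 X)); rewrite addr0 -h.
by rewrite -[a *: u]addr0 H c0 addr0.
Qed.

Lemma inner_cov_le C : 0 <= C ->
  (forall p, operator_norm g (fun v : tangent p => nabla p v X) <= C%:E)%E ->
  forall p (w : tangent p), g p (nabla p w X) w <= C * g p w w.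
Proof.
move=> C0 H p w.
have [->|w0] := eqVneq w 0; first by rewrite (inner_sym g _ 0) !inner0 mulr0.
have ww := inner_gt0 g w0.
pose s := (Num.sqrt (g p w w))^-1.
have s2 : s ^+ 2 * g p w w = 1 by rewrite exprVn sqr_sqrtr ?ltW// mulVf// gt_eqF.
have B : tangent_norm g (nabla p (s *: w) X) <= C.
  rewrite -lee_fin; apply: le_trans (H p); apply: ereal_sup_ubound.
  by exists (s *: w) => //=; rewrite /tangent_norm inner_scale s2 sqrtr1.
have B2 : g p (nabla p w X) (nabla p w X) <= C ^+ 2 * g p w w.
  have : tangent_norm g (nabla p (s *: w) X) ^+ 2 <= C ^+ 2.
    by rewrite ler_sqr ?nnegrE// tangent_norm_ge0.
  rewrite /tangent_norm sqr_sqrtr ?inner_ge0// covZ inner_scale => h.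
  have := ler_wpM2r (ltW ww) h.
  by rewrite mulrAC s2 mul1r.
have B3 := inner_CS g (nabla p w X) w.
have B4 : g p (nabla p w X) w ^+ 2 <= (C * g p w w) ^+ 2.
  apply: le_trans B3 _; rewrite exprMn expr2 [X in _ <= _ * X]expr2 mulrA.
  by rewrite ler_wpM2r// ltW.
apply: le_trans (ler_norm _) _.
by rewrite -ler_sqr ?nnegrE ?mulr_ge0 ?(ltW ww)// real_normK ?num_real.
Qed.

End NormBound.

Section FlowCurves.
Context {R : realType} {n : nat} {M : smoothManifold R n}.
Variables (X : vfield M) (g : riemannian_metric M) (nabla : affine_connection M) (C : R).
Hypothesis sX : smooth_vfield [set: M] X.
Hypothesis cX : complete_vfield X.
Hypothesis lc : levi_civita g nabla.
Hypothesis C0 : 0 <= C.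
Hypothesis HC : forall q (w : tangent q), g q (nabla q w X) w <= C * g q w w.

Lemma flow_C1_curve (J : set R) (sg : R -> M) t : 0 <= t -> open J -> C1_curve J sg ->
  C1_curve J (fun s => flow X t (sg s)) /\
  forall s, J s -> speed g (fun s => flow X t (sg s)) s <= expR (C * t) * speed g sg s.
Proof.
move=> t0 oJ HJ; have [cs _] := HJ.
have H s : J s -> exists w' : tangent (flow X t (sg s)),
    @strict_velocity _ _ M (fun s' => flow X t (sg s')) s w' /\
    g _ w' w' <= expR (2 * C * t) * g _ (velocity sg s) (velocity sg s).
  move=> Js; apply: (flow_strict sX cX lc C0 HC (cs s Js)) => //.
  exact: C1_strict_velocity Js.
split.
  apply: strict_C1_curve => // s Js.
    by apply: continuous_comp; [exact: cs|exact: (flow_continuous g)].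
  by have [w' [sw _]] := H s Js; exists w'.
move=> s Js; have [w' [sw gw]] := H s Js.
rewrite /speed (strict_velocityE sw) /tangent_norm.
have -> : expR (C * t) = Num.sqrt (expR (2 * C * t)).
  by rewrite -mulrA expRM_natl sqrtr_sqr ger0_norm// expR_ge0.
by rewrite -sqrtrM ?expR_ge0// ler_wsqrtr.
Qed.

Lemma flow_curve_length a b (gamma : R -> M) t : 0 <= t -> piecewise_C1 a b gamma ->
  piecewise_C1 a b (fun s => flow X t (gamma s)) /\
  (curve_length g a b (fun s => flow X t (gamma s)) <=
    curve_length g a b gamma * (expR (C * t))%:E)%E.
Proof.
move=> t0 [gc [N [tau [ta tb Hp]]]]; split.
  split.
    move=> s; apply: (@continuous_comp _ _ _ (gamma : subspace _ -> M) (flow X t)); first exact: gc.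
    exact: (flow_continuous g).
  exists N, tau; split => // i iN; have [tt [J [sg [oJ Jsub HJ E]]]] := Hp i iN.
  split => //; exists J, (fun s => flow X t (sg s)); split => //.
    exact: (flow_C1_curve t0 oJ HJ).1.
  by move=> s /E ->.
apply: (@integral_le_off_finite R a b (expR (C * t)) (tau @` `I_N.+1)
  (speed g (fun s => flow X t (gamma s))) (speed g gamma)).
- exact: finite_image.
- by exists 0%N.
- by exists N => /=.
- exact: expR_ge0.
- by move=> s; exact: tangent_norm_ge0.
- by move=> s; exact: tangent_norm_ge0.
move=> s sab nS.
have [|i iN|i iN si] := @piecewise_point R N tau s.
- by rewrite ta tb.
- by move=> e; apply: nS; exists i.
have [_ [J [sg [oJ Jsub HJ E]]]] := Hp i iN.
pose O : set R := `]tau i, tau i.+1[%classic.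
have oO : open O by exact: itv_open.
have OE u : O u -> tau i <= u <= tau i.+1.
  by rewrite /O /= in_itv /= => /andP[? ?]; rewrite !ltW.
have Os : O s by rewrite /O /= in_itv.
have HO : C1_curve O gamma.
  apply: (@C1_curve_ext _ _ _ O sg) => //; first by move=> u /OE; exact: E.
  by apply: C1_curve_sub HJ => u /OE ui; apply: Jsub; rewrite /= in_itv.
have [HO' Hs] := flow_C1_curve t0 oO HO.
by split; [exact: speed_continuous HO' _ Os|exact: speed_continuous HO _ Os|exact: Hs].
Qed.

End FlowCurves.

Theorem theorem2 (R : realType) (n : nat) (M : smoothManifold R n)
    (g : riemannian_metric M) (nabla : affine_connection M)
    (X : vfield M) (p0 q0 : M) :
  connected [set: M] ->
  levi_civita g nabla ->
  smooth_vfield [set: M] X ->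
  complete_vfield X ->
  let C : \bar R :=
    ereal_sup [set operator_norm g (fun v : tangent p => nabla p v X) |
               p in [set: M]] in
  (C < +oo)%E ->
  forall t : R, 0 <= t ->
    (riemannian_dist g (flow X t p0) (flow X t q0)
       <= riemannian_dist g p0 q0 * (expR (fine C * t))%:E)%E.
Proof.
move=> _ lc sX cX C Coo t t0.
have Cub p : (operator_norm g (fun v : tangent p => nabla p v X) <= C)%E.
  by apply: ereal_sup_ubound; exists p.
have C0 : (0 <= C)%E.
  apply: le_trans (Cub p0); apply: (@le_trans _ _ (tangent_norm g (nabla p0 0 X))%:E).
    by rewrite lee_fin; exact: tangent_norm_ge0.
  apply: ereal_sup_ubound; exists 0 => //=.
  by rewrite /tangent_norm inner0 sqrtr0 ler01.
have CE : C = (fine C)%:E by rewrite fineK// ge0_fin_numE.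
have fC0 : 0 <= fine C by rewrite fine_ge0.
have HC := @inner_cov_le R n M g nabla X sX (fine C) fC0.
have {}HC : forall p (w : tangent p), g p (nabla p w X) w <= fine C * g p w w.
  by apply: HC => p; rewrite -CE.
rewrite -lee_pdivrMr ?expR_gt0//; apply: le_ereal_inf_tmp => L [a [b [gamma [ab ga gb pg ->]]]].
rewrite lee_pdivrMr ?expR_gt0//.
have [pg' Lle] := flow_curve_length sX cX lc fC0 HC t0 pg.
apply: le_trans Lle; apply: ereal_inf_lbound.
by exists a, b, (fun s => flow X t (gamma s)); split => //; rewrite ?ga ?gb.
Qed.
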